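(* Let $f \in C((0,\infty);(0,\infty))$ be asymptotically increasing with $\lim_{x\to\infty} f(x)/x = \infty$, let $w \in C([0,\infty);[0,\infty))$ with $w(0)>0$, and let $h \in C(\mathbb{R};\mathbb{R})$ satisfy $H(t) := \int_0^t h(s)\,ds \ge 0$ for each $t\ge 0$. Consider \[ x'(t) = h(t) + \int_0^t w(t-s) f(x(s))\,ds, \quad t \ge 0; \qquad x(0)=\psi>0. \] If \[ \int_\eta^\infty \frac{du}{\sqrt{\int_0^u f(s)\,ds}} = \infty \quad \text{for all } \eta>0, \] then solutions satisfy $x \in C([0,\infty);(0,\infty))$. If furthermore $x\mapsto f(x)/x$ is eventually increasing, $f$ is increasing, and $w \in L^1([0,\infty))$, then the following are equivalent: (i) $\displaystyle \limsup_{t\to\infty} \frac{F_U(H(t))}{t} \le \sqrt{2w(0)}$; (ii) $\displaystyle \lim_{t\to\infty} \frac{F_U(x(t))}{t} = \sqrt{2w(0)}$, where $F_U(x) = \int_1^x \frac{du}{\sqrt{\int_0^u f(s)\,ds}}$ for $x>0$.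
   Context: ''$f$ is asymptotically increasing'' means that there is a continuous increasing function $\phi:(0,\infty)\to(0,\infty)$ with $f(x)/\phi(x)\to 1$ as $x\to\infty$. A function $g$ is eventually increasing if there is $X$ such that $g$ is increasing on $[X,\infty)$. *)

(* Defs.v *)
From Stdlib Require Import Reals.
From Coquelicot Require Import Coquelicot.
Open Scope R_scope.

Definition asymp_increasing (f : R -> R) : Prop :=
  exists phi : R -> R,
    (forall x, 0 < x -> continuous phi x) /\
    (forall x, 0 < x -> 0 < phi x) /\
    (forall x y, 0 < x -> x < y -> phi x <= phi y) /\
    is_lim (fun x => f x / phi x) p_infty 1.

Definition eventually_increasing (g : R -> R) : Prop :=
  exists X, forall x y, X <= x -> x < y -> g x <= g y.

Definition Hint (h : R -> R) (t : R) : R := RInt h 0 t.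

(* int_0^u f(s) ds, an (improper at 0) Riemann integral, f given on (0,oo) *)
Definition Fprim (f : R -> R) (u : R) : R :=
  RInt_gen f (at_right 0) (at_point u).

Definition F_U (f : R -> R) (x : R) : R :=
  RInt (fun u => / sqrt (Fprim f u)) 1 x.

Definition is_solution (f w h : R -> R) (psi : R) (T : Rbar) (x : R -> R) : Prop :=
  x 0 = psi /\
  (forall t, 0 <= t -> Rbar_lt t T ->
     filterlim x (within (fun s => 0 <= s) (locally t)) (locally (x t))) /\
  (forall t, 0 < t -> Rbar_lt t T ->
     is_derive x t (h t + RInt (fun s => w (t - s) * f (x s)) 0 t)).

(* Main.v *)
(** Solutions are compared with those of [y'' = b f(y)], whose energy identity is
    [y'^2 = 2 b F(y)] with [F(u) = int_0^u f]; equivalently [F_U(y)' = sqrt (2 b)].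

    A priori bound: on [0,T] the kernel is bounded by a constant [W] and [f] by a nondecreasing
    [g] that still satisfies the Osgood condition, so a solution lies below some [z] with
    [z'' <= W g(z)], and [z] cannot blow up. The same bound holds when the feedback [f (x s)] is
    delayed, [f (x (s - 1/n))]. The delayed equations are solved by finite iteration, and a
    locally uniform limit of their solutions solves the original equation.

    Asymptotics: let [E] be the inverse of [F_U], so that [y t = E (c t)] solves
    [y'' = (c^2 / 2) f(y)]. Since [f(x)/x] tends to infinity, [E] grows faster than any
    exponential, so that the memory older than any fixed [d > 0] is negligible and only [w 0]
    matters. Hence [E (c t)], suitably shifted in time, is eventually a subsolution if
    [c < sqrt (2 w 0)], and a supersolution if [c > sqrt (2 w 0)] as soon as [H] stays below
    [E (c' t)] for some [c' < c]. Conversely [H <= x]. *)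
Require Import Defs.
From Stdlib Require Import Reals Lra Lia Classical Cantor IndefiniteDescription.
From Coquelicot Require Import Coquelicot.
Open Scope R_scope.

(** * Continuity, derivatives and integrals *)

(** No Lipschitz condition on [f] is assumed, so no contraction argument is at hand: the delay makes
    the equation explicit, and compactness recovers a solution. The bounds for this must not depend
    on the delay, hence the order [exists M, forall x d S] in them. Since [f] need not be monotone,
    an upper bound for x does not pass to [f (x s)]; the majorant g is built from the monotone
    function to which [f] is asymptotic.

    For the growth rate, the comparison with y'' = b f(y), b = c^2 / 2, is made between first
    derivatives. With Y = E (c t) and v = Y', the identity v' = b f(Y) says that b times the
    integral of f(Y) over [t - d, t] is v(t) - v(t - d), and v(t - d) is negligible against v(t). On
    [0, d] the kernel is close to its value at 0, so every c on the proper side of the critical rate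
    leaves a margin. This margin pays for the memory older than d and, in the upper bound, for psi +
    H. *)

Lemma continuous_eps (f : R -> R) (x : R) :
  continuous f x <->
  (forall eps, 0 < eps -> exists del, 0 < del /\
     forall y, Rabs (y - x) < del -> Rabs (f y - f x) < eps).
Proof.
  unfold continuous; split.
  - intros Hc eps He.
    destruct (proj1 (filterlim_locally _ _) Hc (mkposreal eps He)) as [d Hd].
    exists d; split; [apply cond_pos|]. intros y Hy; apply (Hd y Hy).
  - intros Hc; apply filterlim_locally; intros eps.
    destruct (Hc eps (cond_pos eps)) as [d [Hd H]].
    exists (mkposreal d Hd); intros y Hy; apply (H y Hy).
Qed.

Lemma continuous_Rplus (f g : R -> R) (x : R) :
  continuous f x -> continuous g x -> continuous (fun x => f x + g x) x.
Proof. intros Hf Hg; exact (continuous_plus f g x Hf Hg). Qed.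

Lemma continuous_Rminus (f g : R -> R) (x : R) :
  continuous f x -> continuous g x -> continuous (fun x => f x - g x) x.
Proof. intros Hf Hg; exact (continuous_minus f g x Hf Hg). Qed.

Lemma continuous_Rmult (f g : R -> R) (x : R) :
  continuous f x -> continuous g x -> continuous (fun x => f x * g x) x.
Proof. intros Hf Hg; exact (continuous_mult f g x Hf Hg). Qed.

Lemma continuous_Rmax_l (a x : R) : continuous (Rmax a) x.
Proof.
  apply continuous_eps; intros eps He; exists eps; split; [lra|]; intros y Hy.
  revert Hy; unfold Rmax; destruct (Rle_dec a y), (Rle_dec a x);
    unfold Rabs; repeat destruct Rcase_abs; lra.
Qed.

Lemma continuous_Rmin_l (a x : R) : continuous (Rmin a) x.
Proof.
  apply continuous_eps; intros eps He; exists eps; split; [lra|]; intros y Hy.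
  revert Hy; unfold Rmin; destruct (Rle_dec a y), (Rle_dec a x);
    unfold Rabs; repeat destruct Rcase_abs; lra.
Qed.

(** Kernel and solutions live on [0, oo) and are only one-sidedly continuous at 0. Composition with
    [Rmax 0] makes them continuous on all of R, as the integration lemmas below ask. *)
Lemma continuous_clip (f : R -> R) (t : R) :
  filterlim f (within (fun s => 0 <= s) (locally (Rmax 0 t))) (locally (f (Rmax 0 t))) ->
  continuous (fun t => f (Rmax 0 t)) t.
Proof.
  intros Hf.
  apply (filterlim_comp _ _ _ (Rmax 0) f (locally t)
    (within (fun s => 0 <= s) (locally (Rmax 0 t)))); [|exact Hf].
  intros P HP. unfold within in HP.
  generalize (continuous_Rmax_l 0 t _ HP); unfold filtermap.
  apply filter_imp; intros y Hy; apply Hy, Rmax_l.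
Qed.

Lemma ex_RInt_cont (f : R -> R) (a b : R) :
  (forall x, continuous f x) -> ex_RInt f a b.
Proof. intros Hf; apply (ex_RInt_continuous (V := R_CompleteNormedModule)); auto. Qed.

Lemma RInt_Rplus (f g : R -> R) (a b : R) :
  ex_RInt f a b -> ex_RInt g a b ->
  RInt (fun x => f x + g x) a b = RInt f a b + RInt g a b.
Proof. intros Hf Hg; exact (RInt_plus f g a b Hf Hg). Qed.

Lemma RInt_Rminus (f g : R -> R) (a b : R) :
  ex_RInt f a b -> ex_RInt g a b ->
  RInt (fun x => f x - g x) a b = RInt f a b - RInt g a b.
Proof. intros Hf Hg; exact (RInt_minus f g a b Hf Hg). Qed.

Lemma RInt_Rscal (f : R -> R) (a b l : R) :
  ex_RInt f a b -> RInt (fun x => l * f x) a b = l * RInt f a b.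
Proof. intros Hf; exact (RInt_scal f a b l Hf). Qed.

Lemma RInt_split (f : R -> R) (a b c : R) :
  ex_RInt f a b -> ex_RInt f b c -> RInt f a c = RInt f a b + RInt f b c.
Proof. intros H1 H2; symmetry; exact (RInt_Chasles f a b c H1 H2). Qed.

Lemma RInt_abs_le (f : R -> R) (a b M : R) :
  ex_RInt f a b ->
  (forall t, Rmin a b <= t <= Rmax a b -> Rabs (f t) <= M) ->
  Rabs (RInt f a b) <= Rabs (b - a) * M.
Proof.
  intros Hex HM. apply (norm_RInt_le_const_abs (V := R_NormedModule) f a b); [exact HM|].
  apply (RInt_correct f); exact Hex.
Qed.

Lemma is_derive_RInt_cont (f : R -> R) (a x : R) :
  (forall x, continuous f x) -> is_derive (fun t => RInt f a t) x (f x).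
Proof.
  intros Hf. apply (is_derive_RInt f _ a); [|apply Hf].
  exists (mkposreal 1 Rlt_0_1); intros y _. apply (RInt_correct f), ex_RInt_cont, Hf.
Qed.

Lemma is_derive_continuous (f : R -> R) (x l : R) :
  is_derive f x l -> continuous f x.
Proof. intros H; apply (ex_derive_continuous (V := R_NormedModule)); exists l; exact H. Qed.

Lemma is_derive_affine (c d x : R) : is_derive (fun t => c * t + d) x c.
Proof. auto_derive; [exact I|ring]. Qed.

Lemma is_derive_linear (c x : R) : is_derive (fun t => c * t) x c.
Proof. auto_derive; [exact I|ring]. Qed.

Lemma is_derive_shift (d x : R) : is_derive (fun t => t + d) x 1.
Proof. auto_derive; [exact I|ring]. Qed.

Lemma nondecreasing_of_derive (f df : R -> R) (a b : R) :
  a <= b ->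
  (forall x, a < x < b -> is_derive f x (df x)) ->
  (forall x, a <= x <= b -> continuous f x) ->
  (forall x, a < x < b -> 0 <= df x) -> f a <= f b.
Proof.
  intros Hab Hd Hc Hp.
  (* The intermediate point may be an endpoint, where the sign of [df] is unknown; [Rmax 0 (df x)]
     agrees with [df] inside and is nonnegative everywhere. *)
  destruct (MVT_gen f a b (fun x => Rmax 0 (df x))) as [c [_ Hc2]];
    rewrite ?Rmin_left, ?Rmax_right by lra.
  - intros x Hx. rewrite Rmax_right by auto. auto.
  - intros x Hx. apply continuity_pt_filterlim, Hc, Hx.
  - generalize (Rmult_le_pos _ (b - a) (Rmax_l 0 (df c))). lra.
Qed.

Lemma derive_le (f g df dg : R -> R) (a b : R) :
  a <= b ->
  (forall x, a < x < b -> is_derive f x (df x)) ->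
  (forall x, a < x < b -> is_derive g x (dg x)) ->
  (forall x, a <= x <= b -> continuous f x) ->
  (forall x, a <= x <= b -> continuous g x) ->
  (forall x, a < x < b -> df x <= dg x) -> f b - f a <= g b - g a.
Proof.
  intros Hab Hf Hg Hcf Hcg Hle.
  assert (H := nondecreasing_of_derive (fun x => g x - f x) (fun x => dg x - df x) a b Hab).
  cut (g a - f a <= g b - f b); [lra|]. apply H.
  - intros x Hx. apply (is_derive_minus g f x (dg x) (df x)); auto.
  - intros x Hx. apply continuous_Rminus; auto.
  - intros x Hx. specialize (Hle x Hx). lra.
Qed.

Lemma derive_eq (f g df : R -> R) (a b : R) :
  a <= b ->
  (forall x, a < x < b -> is_derive f x (df x)) ->
  (forall x, a < x < b -> is_derive g x (df x)) ->
  (forall x, a <= x <= b -> continuous f x) ->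
  (forall x, a <= x <= b -> continuous g x) -> f b - f a = g b - g a.
Proof.
  intros Hab Hf Hg Hcf Hcg. apply Rle_antisym.
  - exact (derive_le f g df df a b Hab Hf Hg Hcf Hcg (fun x _ => Rle_refl _)).
  - exact (derive_le g f df df a b Hab Hg Hf Hcg Hcf (fun x _ => Rle_refl _)).
Qed.

Lemma continuous_bounded (f : R -> R) (a b : R) :
  (forall x, a <= x <= b -> continuous f x) ->
  exists M, 0 < M /\ forall x, a <= x <= b -> Rabs (f x) <= M.
Proof.
  intros Hc. destruct (Rle_dec a b) as [Hab|Hab].
  - destruct (continuity_ab_maj (fun x => Rabs (f x)) a b Hab) as [m [Hm _]].
    { intros c Hc'. apply continuity_pt_filterlim.
      apply (continuous_comp f Rabs); [auto|].
      apply continuity_pt_filterlim, Rcontinuity_abs. }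
    exists (Rabs (f m) + 1); split; [generalize (Rabs_pos (f m)); lra|].
    intros x Hx; specialize (Hm x Hx); lra.
  - exists 1; split; [lra|]; intros x Hx; lra.
Qed.

Lemma continuous_uniform (f : R -> R) (a b eps : R) :
  0 < eps -> (forall x, a <= x <= b -> continuous f x) ->
  exists del, 0 < del /\ forall x y, a <= x <= b -> a <= y <= b ->
    Rabs (x - y) < del -> Rabs (f x - f y) < eps.
Proof.
  intros He Hc.
  assert (Hc' : forall x, a <= x <= b -> continuity_pt f x).
  { intros x Hx; apply continuity_pt_filterlim, Hc, Hx. }
  destruct (Heine f _ (compact_P3 a b) Hc' (mkposreal eps He)) as [d Hd].
  exists d; split; [apply cond_pos|exact Hd].
Qed.

(** The continuation principle behind the comparisons below. Let m be the supremum of the times up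
    to which D stays positive. The step hypothesis gives D m > 0, and continuity carries positivity
    beyond m. *)
Lemma continuous_positivity (D : R -> R) (a : R) :
  (forall t, a <= t -> continuous D t) -> 0 < D a ->
  (forall t, a < t -> (forall s, a <= s < t -> 0 < D s) -> 0 < D t) ->
  forall t, a <= t -> 0 < D t.
Proof.
  intros Hc Ha Hstep t1 Ht1.
  apply Rnot_le_lt; intros Hneg.
  set (A := fun s => a <= s <= t1 /\ forall r, a <= r <= s -> 0 < D r).
  assert (HAa : A a).
  { split; [lra|]. intros r Hr; replace r with a by lra; exact Ha. }
  assert (HAb : bound A) by (exists t1; intros s [Hs _]; lra).
  destruct (completeness A HAb (ex_intro _ a HAa)) as [m [Hub Hlub]].
  assert (Ham : a <= m) by (apply Hub, HAa).
  assert (Hmt : m <= t1) by (apply Hlub; intros s [Hs _]; lra).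
  assert (Hbelow : forall s, a <= s < m -> 0 < D s).
  { intros s Hs. apply NNPP; intros Hn.
    assert (m <= s); [|lra]. apply Hlub; intros r [Hr1 Hr2].
    apply Rnot_lt_le; intros Hlt; apply Hn, Hr2; lra. }
  assert (HDm : 0 < D m).
  { destruct (Req_dec m a) as [->|Hne]; [exact Ha|]. apply Hstep; [lra|exact Hbelow]. }
  destruct (proj1 (continuous_eps D m) (Hc m Ham) (D m) HDm) as [del [Hdel Hd]].
  assert (Hpos : forall r, a <= r < m + del -> 0 < D r).
  { intros r Hr. destruct (Rlt_dec r m) as [Hlt|Hge]; [apply Hbelow; lra|].
    assert (Hr' : Rabs (r - m) < del) by (apply Rabs_def1; lra).
    apply Hd, Rabs_def2 in Hr'; lra. }
  destruct (Rlt_dec t1 (m + del)) as [Hlt|Hge].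
  + assert (0 < D t1) by (apply Hpos; lra). lra.
  + assert (m + del / 2 <= m); [|lra]. apply Hub; split; [lra|].
    intros r Hr; apply Hpos; lra.
Qed.

(** * Convolution with a continuous kernel *)

Definition conv (k u : R -> R) (t : R) : R := RInt (fun s => k (t - s) * u s) 0 t.

Lemma continuous_conv_integrand (k u : R -> R) (t s : R) :
  (forall x, continuous k x) -> (forall x, continuous u x) ->
  continuous (fun s => k (t - s) * u s) s.
Proof.
  intros Hk Hu. apply continuous_Rmult; [|apply Hu].
  apply (continuous_comp (fun s => t - s) k); [|apply Hk].
  apply continuous_Rminus; [apply continuous_const|apply continuous_id].
Qed.

(** The time enters twice. Moving the upper limit from t to y costs at most |y - t| K U; moving the
    argument of [k] is controlled by uniform continuity. With A = |t| + 1 all times involved lie in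
    [-A, A] and their differences in [-2 A, 2 A]. *)
Lemma continuous_conv (k u : R -> R) (t : R) :
  (forall x, continuous k x) -> (forall x, continuous u x) ->
  continuous (conv k u) t.
Proof.
  intros Hk Hu. set (A := Rabs t + 1).
  assert (HA : 0 < A) by (unfold A; generalize (Rabs_pos t); lra).
  destruct (continuous_bounded k (- (2 * A)) (2 * A)) as [K [HK HKb]]; [auto|].
  destruct (continuous_bounded u (- A) A) as [U [HU HUb]]; [auto|].
  apply continuous_eps; intros eps He.
  assert (HeA : 0 < eps / (2 * A * U)).
  { apply Rdiv_lt_0_compat; [exact He|]. repeat apply Rmult_lt_0_compat; lra. }
  destruct (continuous_uniform k (- (2 * A)) (2 * A) (eps / (2 * A * U)) HeA)
    as [d [Hd Hdk]]; [auto|].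
  assert (HeKU : 0 < eps / (2 * K * U)).
  { apply Rdiv_lt_0_compat; [exact He|]. repeat apply Rmult_lt_0_compat; lra. }
  exists (Rmin (Rmin d 1) (eps / (2 * K * U))); split.
  { repeat apply Rmin_glb_lt; lra. }
  intros y Hy.
  assert (Hy1 : Rabs (y - t) < d) by
    (eapply Rlt_le_trans; [exact Hy|]; eapply Rle_trans; apply Rmin_l).
  assert (Hy2 : Rabs (y - t) < 1) by
    (eapply Rlt_le_trans; [exact Hy|]; eapply Rle_trans; [apply Rmin_l|apply Rmin_r]).
  assert (Hy3 : Rabs (y - t) < eps / (2 * K * U)) by
    (eapply Rlt_le_trans; [exact Hy|]; apply Rmin_r).
  assert (HtA : - A <= t <= A /\ - A <= y <= A).
  { unfold A. revert Hy2. unfold Rabs; repeat destruct Rcase_abs; intros; lra. }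
  assert (Hex : forall a b r, ex_RInt (fun s => k (r - s) * u s) a b).
  { intros; apply ex_RInt_cont; intros; apply continuous_conv_integrand; auto. }
  unfold conv.
  rewrite (RInt_split (fun s => k (y - s) * u s) 0 t y) by auto.
  replace (RInt (fun s => k (y - s) * u s) 0 t + RInt (fun s => k (y - s) * u s) t y
    - RInt (fun s => k (t - s) * u s) 0 t)
  with (RInt (fun s => k (y - s) * u s) t y
     + RInt (fun s => k (y - s) * u s - k (t - s) * u s) 0 t)
  by (rewrite RInt_Rminus by auto; ring).
  eapply Rle_lt_trans; [apply Rabs_triang|].
  assert (H1 : Rabs (RInt (fun s => k (y - s) * u s) t y) <= Rabs (y - t) * (K * U)).
  { apply RInt_abs_le; [auto|]. intros s Hs. rewrite Rabs_mult.
    assert (- A <= s <= A).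
    { generalize (Rmin_glb t y (- A)), (Rmax_lub t y A); lra. }
    apply Rmult_le_compat; try apply Rabs_pos; [apply HKb|apply HUb]; lra. }
  assert (H2 : Rabs (RInt (fun s => k (y - s) * u s - k (t - s) * u s) 0 t)
     <= Rabs (t - 0) * (eps / (2 * A * U) * U)).
  { apply RInt_abs_le; [apply (ex_RInt_minus (V := R_NormedModule)); auto|].
    intros s Hs.
    replace (k (y - s) * u s - k (t - s) * u s) with ((k (y - s) - k (t - s)) * u s) by ring.
    rewrite Rabs_mult.
    assert (- A <= s <= A).
    { generalize (Rmin_glb 0 t (- A)), (Rmax_lub 0 t A); lra. }
    apply Rmult_le_compat; try apply Rabs_pos; [|apply HUb; lra].
    apply Rlt_le, Hdk; try lra. replace (y - s - (t - s)) with (y - t) by ring; lra. }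
  assert (H3 : Rabs (y - t) * (K * U) < eps / 2).
  { replace (eps / 2) with (eps / (2 * K * U) * (K * U)) by (field; lra).
    apply Rmult_lt_compat_r; [apply Rmult_lt_0_compat; lra|lra]. }
  assert (H4 : Rabs (t - 0) * (eps / (2 * A * U) * U) <= eps / 2).
  { replace (eps / 2) with (A * (eps / (2 * A * U) * U)) by (field; lra).
    apply Rmult_le_compat_r; [apply Rmult_le_pos; lra|].
    rewrite Rminus_0_r; unfold A; lra. }
  lra.
Qed.

(** * Equi-Lipschitz sequences of functions *)

Definition nonneg_rational (i : nat) : R :=
  INR (fst (Cantor.of_nat i)) / INR (S (snd (Cantor.of_nat i))).

Lemma exists_inv_INR_lt (eps : R) : 0 < eps -> exists N, forall n, (N <= n)%nat -> / INR (S n) < eps.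
Proof.
  intros He. destruct (nfloor_ex (/ eps)) as [N [_ HN]].
  { apply Rlt_le, Rinv_0_lt_compat, He. }
  exists N; intros n Hn. rewrite <- (Rinv_inv eps). apply Rinv_lt_contravar.
  - apply Rmult_lt_0_compat; [apply Rinv_0_lt_compat, He|apply lt_0_INR; lia].
  - eapply Rlt_le_trans; [exact HN|]. rewrite <- S_INR. apply le_INR; lia.
Qed.

Lemma nat_grid (t eps : R) (m : nat) : 0 <= t -> / INR (S m) < eps ->
  exists i, INR i / INR (S m) <= t /\ t - INR i / INR (S m) < eps.
Proof.
  intros Ht Hm. assert (Hm0 : 0 < INR (S m)) by (apply lt_0_INR; lia).
  destruct (nfloor_ex (t * INR (S m))) as [i [Hi1 Hi2]]; [nra|].
  exists i; split.
  - apply Rmult_le_reg_r with (INR (S m)); [exact Hm0|].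
    unfold Rdiv; rewrite Rmult_assoc, Rinv_l by lra. lra.
  - apply Rlt_trans with (/ INR (S m)); [|exact Hm].
    apply Rmult_lt_reg_r with (INR (S m)); [exact Hm0|].
    unfold Rdiv. rewrite Rmult_minus_distr_r, Rmult_assoc, !Rinv_l by lra. lra.
Qed.

Lemma nonneg_rational_ge0 (i : nat) : 0 <= nonneg_rational i.
Proof.
  unfold nonneg_rational, Rdiv. apply Rmult_le_pos; [apply pos_INR|].
  apply Rlt_le, Rinv_0_lt_compat, lt_0_INR; lia.
Qed.

Lemma nonneg_rational_dense (t eps : R) : 0 <= t -> 0 < eps ->
  exists i, Rabs (t - nonneg_rational i) < eps.
Proof.
  intros Ht He. destruct (exists_inv_INR_lt eps He) as [m Hm].
  destruct (nat_grid t eps m Ht (Hm m (le_n m))) as [i [Hi1 Hi2]].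
  exists (Cantor.to_nat (i, m)). unfold nonneg_rational.
  rewrite Cantor.cancel_of_to. simpl fst; simpl snd.
  apply Rabs_def1; lra.
Qed.

Lemma eventually_forall_lt (P : nat -> nat -> Prop) (m : nat) :
  (forall i, exists K, forall k, (K <= k)%nat -> P i k) ->
  exists K, forall k, (K <= k)%nat -> forall i, (i < m)%nat -> P i k.
Proof.
  intros HP. induction m as [|m [K HK]]; [exists 0%nat; intros; lia|].
  destruct (HP m) as [K' HK']. exists (max K K'); intros k Hk i Hi.
  destruct (Nat.eq_dec i m) as [->|Hne]; [apply HK'; lia|apply HK; lia].
Qed.

Section ArzelaAscoli.
Context (z : nat -> R -> R) (c : R) (z_0 : forall n, z n 0 = c)
  (z_lip : forall T, exists N L, 0 < L /\ forall n, (N <= n)%nat ->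
     forall s t, 0 <= s <= T -> 0 <= t <= T -> Rabs (z n t - z n s) <= L * Rabs (t - s)).

(** A joint cluster value of the first k sequences: arbitrarily late indices n match all k values at
    once. It takes the place of nested subsequences in the diagonal argument. *)
Definition partial_cluster (k : nat) (y : nat -> R) : Prop :=
  forall eps N, 0 < eps -> exists n, (N <= n)%nat /\
    forall i, (i < k)%nat -> Rabs (z n (nonneg_rational i) - y i) < eps.

(** Pick indices n j along which the first k values converge. The Lipschitz bound and the common
    value at 0 confine [z (n j) (d k)] to a compact interval, and a Bolzano-Weierstrass cluster
    value there extends y. *)
Lemma partial_cluster_S (k : nat) (y : nat -> R) : partial_cluster k y ->
  exists y', partial_cluster (S k) y' /\ forall i, (i < k)%nat -> y' i = y i.
Proof.
  intros Hy. set (d := nonneg_rational).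
  assert (Hd := nonneg_rational_ge0 k). fold d in Hd.
  destruct (z_lip (d k)) as [N [L [HL HNL]]].
  assert (Hb : forall n, (N <= n)%nat -> c - L * d k <= z n (d k) <= c + L * d k).
  { intros n Hn. specialize (HNL n Hn 0 (d k)). rewrite z_0, Rminus_0_r in HNL.
    rewrite (Rabs_pos_eq (d k)) in HNL by exact Hd.
    apply Rabs_le_between' in HNL; lra. }
  destruct (functional_choice (fun j n => (max j N <= n)%nat /\
    forall i, (i < k)%nat -> Rabs (z n (d i) - y i) < / INR (S j))) as [n Hn].
  { intros j. apply Hy. apply Rinv_0_lt_compat, lt_0_INR; lia. }
  destruct (Bolzano_Weierstrass (fun j => z (n j) (d k)) _
    (compact_P3 (c - L * d k) (c + L * d k))) as [v Hv].
  { intros j. apply Hb. destruct (Hn j); lia. }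
  exists (fun i => if Nat.eq_dec i k then v else y i); split.
  - intros eps M He. destruct (exists_inv_INR_lt eps He) as [J HJ].
    destruct (Hv (disc v (mkposreal eps He)) (max J M)) as [p [Hp1 Hp2]].
    { exists (mkposreal eps He); intros r Hr; exact Hr. }
    destruct (Hn p) as [Hn1 Hn2].
    exists (n p); split; [lia|]. intros i Hi.
    destruct (Nat.eq_dec i k) as [->|Hne]; [exact Hp2|].
    eapply Rlt_trans; [apply Hn2; lia|]. apply HJ; lia.
  - intros i Hi. destruct (Nat.eq_dec i k); [lia|reflexivity].
Qed.

Lemma diagonal_cluster : exists y, forall k, partial_cluster k y.
Proof.
  destruct (functional_choice (fun (p : nat * (nat -> R)) y' =>
    partial_cluster (fst p) (snd p) ->
    partial_cluster (S (fst p)) y' /\ forall i, (i < fst p)%nat -> y' i = snd p i)) as [next Hnext].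
  { intros [k y]; simpl. destruct (classic (partial_cluster k y)) as [H|H].
    - destruct (partial_cluster_S k y H) as [y' Hy']; exists y'; auto.
    - exists y; intros H'; contradiction. }
  set (Y := fix Y (k : nat) : nat -> R :=
    match k with O => fun _ => 0 | S k => next (k, Y k) end).
  assert (HY : forall k, partial_cluster k (Y k)).
  { induction k as [|k IH].
    - intros eps N _; exists N; split; [lia|intros; lia].
    - apply (Hnext (k, Y k) IH). }
  assert (Hstab : forall i m, Y (S i + m)%nat i = Y (S i) i).
  { intros i; induction m as [|m IH]; [rewrite Nat.add_0_r; reflexivity|].
    rewrite <- IH. replace (S i + S m)%nat with (S (S i + m)) by lia.
    apply (proj2 (Hnext (S i + m, Y (S i + m))%nat (HY _))). simpl; lia. }
  (* Coordinate i is fixed at stage i + 1 and never changed afterwards. *)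
  exists (fun i => Y (S i) i); intros k eps N He.
  destruct (HY k eps N He) as [n [Hn1 Hn2]]. exists n; split; [exact Hn1|].
  intros i Hi. rewrite <- (Hstab i (k - S i)%nat).
  replace (S i + (k - S i))%nat with k by lia. apply Hn2, Hi.
Qed.

(** Along the diagonal indices m k the sequence converges at the rationals, hence is Cauchy at every
    t >= 0 by the common Lipschitz constant; the limit inherits that constant, and a finite grid
    makes the convergence uniform on [0, T]. Closeness at arbitrarily late indices is all that the
    limit passage uses. *)
Lemma arzela_ascoli :
  exists x, forall T eps N, 0 < eps -> exists n, (N <= n)%nat /\
    forall t, 0 <= t <= T -> Rabs (z n t - x t) <= eps.
Proof.
  destruct diagonal_cluster as [y Hy].
  destruct (functional_choice (fun k n => (k <= n)%nat /\
    forall i, (i < k)%nat -> Rabs (z n (nonneg_rational i) - y i) < / INR (S k))) as [m Hm].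
  { intros k. apply Hy, Rinv_0_lt_compat, lt_0_INR; lia. }
  assert (Hconv : forall i eps, 0 < eps -> exists K, forall k, (K <= k)%nat ->
    Rabs (z (m k) (nonneg_rational i) - y i) < eps).
  { intros i eps He. destruct (exists_inv_INR_lt eps He) as [K HK].
    exists (max K (S i)); intros k Hk. eapply Rlt_trans; [apply Hm; lia|apply HK; lia]. }
  assert (Hlim : forall t, exists l : R, 0 <= t -> is_lim_seq (fun k => z (m k) t) l).
  { intros t. destruct (Rle_dec 0 t) as [Ht|Ht]; [|exists 0; intros; lra].
    assert (Hc : ex_finite_lim_seq (fun k => z (m k) t)).
    { apply ex_lim_seq_cauchy_corr. intros [eps He]; simpl.
      destruct (z_lip (t + 1)) as [N [L [HL HNL]]].
      assert (He4 : 0 < Rmin 1 (eps / (4 * L))).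
      { apply Rmin_glb_lt; [lra|]. apply Rdiv_lt_0_compat; lra. }
      destruct (nonneg_rational_dense t _ Ht He4) as [i Hi].
      assert (Hi1 : Rabs (t - nonneg_rational i) < 1).
      { eapply Rlt_le_trans; [exact Hi|apply Rmin_l]. }
      assert (Hi2 : L * Rabs (t - nonneg_rational i) < eps / 4).
      { replace (eps / 4) with (L * (eps / (4 * L))) by (field; lra).
        apply Rmult_lt_compat_l; [exact HL|]. eapply Rlt_le_trans; [exact Hi|apply Rmin_r]. }
      apply Rabs_def2 in Hi1. assert (Hr := nonneg_rational_ge0 i).
      destruct (Hconv i (eps / 4)) as [K HK]; [lra|].
      assert (Hone : forall k, (max K N <= k)%nat -> Rabs (z (m k) t - y i) < eps / 2).
      { intros k Hk. destruct (Hm k) as [Hmk _].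
        assert (Hz := HNL (m k) ltac:(lia) (nonneg_rational i) t ltac:(lra) ltac:(lra)).
        specialize (HK k ltac:(lia)).
        replace (z (m k) t - y i) with ((z (m k) t - z (m k) (nonneg_rational i))
          + (z (m k) (nonneg_rational i) - y i)) by ring.
        eapply Rle_lt_trans; [apply Rabs_triang|]. lra. }
      exists (max K N); intros a b Ha Hb.
      replace (z (m a) t - z (m b) t) with ((z (m a) t - y i) - (z (m b) t - y i)) by ring.
      eapply Rle_lt_trans; [apply Rabs_triang|]. rewrite Rabs_Ropp.
      generalize (Hone a Ha) (Hone b Hb). lra. }
    destruct Hc as [l Hl]; exists l; auto. }
  apply functional_choice in Hlim. destruct Hlim as [x Hx].
  exists x; intros T eps N He.
  destruct (z_lip T) as [N1 [L [HL HNL]]].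
  assert (Hxlip : forall s t, 0 <= s <= T -> 0 <= t <= T -> Rabs (x t - x s) <= L * Rabs (t - s)).
  { intros s t Hs Ht.
    assert (H1 := is_lim_seq_minus' _ _ _ _ (Hx t (proj1 Ht)) (Hx s (proj1 Hs))).
    apply is_lim_seq_abs in H1.
    refine (is_lim_seq_le_loc _ (fun _ => L * Rabs (t - s)) (Finite _) (Finite _) _ H1
      (is_lim_seq_const _)).
    exists N1; intros k Hk. apply HNL; auto. destruct (Hm k); lia. }
  (* On a grid of mesh below eps / (3 L) the error splits into three thirds: moving [z (m k)] to the
     grid point, convergence at the finitely many grid points, moving x back. *)
  assert (He3 : 0 < eps / (3 * L)) by (apply Rdiv_lt_0_compat; lra).
  destruct (exists_inv_INR_lt _ He3) as [p Hp]. specialize (Hp p (le_n p)).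
  assert (Hp0 : 0 < INR (S p)) by (apply lt_0_INR; lia).
  destruct (nfloor_ex (Rmax 0 (T * INR (S p))) (Rmax_l _ _)) as [q [_ Hq]].
  destruct (eventually_forall_lt (fun i k =>
    Rabs (z (m k) (INR i / INR (S p)) - x (INR i / INR (S p))) < eps / 3) (S q)) as [K HK].
  { intros i. assert (Hi : 0 <= INR i / INR (S p)).
    { apply Rmult_le_pos; [apply pos_INR|apply Rlt_le, Rinv_0_lt_compat, Hp0]. }
    assert (He' : 0 < eps / 3) by lra. assert (Hl := Hx _ Hi).
    apply is_lim_seq_spec in Hl. destruct (Hl (mkposreal _ He')) as [K HK].
    exists K; exact HK. }
  set (k := max K (max N N1)). destruct (Hm k) as [Hmk _].
  exists (m k); split; [lia|]. intros t Ht.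
  destruct (nat_grid t _ p (proj1 Ht) Hp) as [i [Hi1 Hi2]].
  set (r := INR i / INR (S p)) in *.
  assert (Hr0 : 0 <= r).
  { apply Rmult_le_pos; [apply pos_INR|apply Rlt_le, Rinv_0_lt_compat, Hp0]. }
  assert (Hiq : (i < S q)%nat).
  { apply INR_lt. rewrite (S_INR q). eapply Rle_lt_trans; [|exact Hq].
    eapply Rle_trans; [|apply Rmax_r].
    replace (INR i) with (r * INR (S p)) by (unfold r; field; lra). nra. }
  specialize (HK k ltac:(lia) i Hiq). cbv beta in HK. fold r in HK.
  assert (H1 := HNL (m k) ltac:(lia) r t ltac:(lra) Ht).
  assert (H2 := Hxlip t r Ht ltac:(lra)).
  rewrite (Rabs_minus_sym r t) in H2.
  assert (H3 : L * Rabs (t - r) < eps / 3).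
  { replace (eps / 3) with (L * (eps / (3 * L))) by (field; lra).
    apply Rmult_lt_compat_l; [exact HL|]. rewrite Rabs_pos_eq by lra. exact Hi2. }
  replace (z (m k) t - x t) with ((z (m k) t - z (m k) r) + ((z (m k) r - x r) + (x r - x t))) by ring.
  eapply Rle_trans; [apply Rabs_triang|].
  generalize (Rabs_triang (z (m k) r - x r) (x r - x t)). lra.
Qed.

End ArzelaAscoli.

(** * The potential of the force *)

Lemma ex_RInt_pos (g : R -> R) (a b : R) :
  (forall x, 0 < x -> continuous g x) -> 0 < a -> 0 < b -> ex_RInt g a b.
Proof.
  intros Hg Ha Hb. apply (ex_RInt_continuous (V := R_CompleteNormedModule)).
  intros z [Hz _]. apply Hg. eapply Rlt_le_trans; [|exact Hz].
  apply Rmin_glb_lt; assumption.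
Qed.

Lemma is_derive_RInt_pos (g : R -> R) (a x : R) :
  (forall x, 0 < x -> continuous g x) -> 0 < a -> 0 < x ->
  is_derive (fun t => RInt g a t) x (g x).
Proof.
  intros Hg Ha Hx. apply (is_derive_RInt g _ a); [|apply Hg, Hx].
  exists (mkposreal x Hx); intros y Hy. apply Rabs_def2 in Hy; simpl in Hy.
  apply (RInt_correct g), ex_RInt_pos; auto. unfold minus, plus, opp in Hy; simpl in Hy; lra.
Qed.

Lemma is_lim_p_infty_gt (g : R -> R) (B : R) :
  is_lim g p_infty p_infty -> exists X, forall x, X < x -> B < g x.
Proof.
  intros Hg. apply (Hg (fun y => B < y)). exists B; auto.
Qed.

Lemma is_lim_p_infty_intro (g : R -> R) :
  (forall B, exists X, forall x, X < x -> B < g x) -> is_lim g p_infty p_infty.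
Proof.
  intros Hg P [B HB]. destruct (Hg B) as [X HX]. exists X; auto.
Qed.

Lemma continuous_inv_sqrt (g : R -> R) (x : R) :
  continuous g x -> 0 < g x -> continuous (fun u => / sqrt (g u)) x.
Proof.
  intros Hg Hp. apply (continuous_comp g (fun v => / sqrt v)); [exact Hg|].
  apply continuity_pt_filterlim.
  apply (continuity_pt_inv sqrt); [apply continuity_pt_sqrt; lra|].
  generalize (sqrt_lt_R0 _ Hp); lra.
Qed.

Section Potential.
Context (f : R -> R)
  (f_cont : forall x, 0 < x -> continuous f x)
  (f_pos : forall x, 0 < x -> 0 < f x)
  (f_int0 : ex_RInt_gen f (at_right 0) (at_point 1)).

Lemma ex_RInt_gen_0 (u : R) : 0 < u -> ex_RInt_gen f (at_right 0) (at_point u).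
Proof.
  intros Hu. apply (ex_RInt_gen_Chasles _ 1); [exact f_int0|].
  destruct (ex_RInt_pos f 1 u f_cont) as [l Hl]; [lra|exact Hu|].
  exists l. apply is_RInt_gen_at_point, Hl.
Qed.

Lemma Fprim_split (a u : R) : 0 < a -> 0 < u -> Fprim f u = Fprim f a + RInt f a u.
Proof.
  intros Ha Hu. unfold Fprim.
  assert (Hex := ex_RInt_pos f a u f_cont Ha Hu).
  assert (Hg : is_RInt_gen f (at_point a) (at_point u) (RInt f a u)).
  { apply is_RInt_gen_at_point, (RInt_correct f), Hex. }
  rewrite <- (RInt_gen_Chasles (V := R_CompleteNormedModule) f a).
  - unfold plus; simpl; f_equal. apply (is_RInt_gen_unique f), Hg.
  - apply ex_RInt_gen_0, Ha.
  - exists (RInt f a u); exact Hg.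
Qed.

(** Inequalities for proper integrals pass to the improper one by contradiction with a single close
    value, as in the next lemmas. *)
Lemma Fprim_approx (u eps : R) : 0 < u -> 0 < eps ->
  exists a, 0 < a < u /\ Rabs (RInt f a u - Fprim f u) < eps.
Proof.
  intros Hu He.
  assert (H := RInt_gen_correct f (ex_RInt_gen_0 u Hu)).
  destruct (H (fun y => Rabs (y - Fprim f u) < eps)) as [Q S HQ HS HQS].
  { exists (mkposreal eps He); intros y Hy; exact Hy. }
  destruct HQ as [d Hd].
  set (a := Rmin (d / 2) (u / 2)).
  assert (Ha : 0 < a) by (apply Rmin_glb_lt; [generalize (cond_pos d)|]; lra).
  assert (Had : a < d /\ a < u).
  { generalize (cond_pos d) (Rmin_l (d / 2) (u / 2)) (Rmin_r (d / 2) (u / 2)). unfold a; lra. }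
  destruct (HQS a u) as [y [Hy1 Hy2]]; [|exact HS|].
  { apply Hd; [|exact Ha]. unfold ball; simpl; unfold AbsRing_ball, abs, minus, plus, opp; simpl.
    apply Rabs_def1; lra. }
  exists a; split; [lra|]. rewrite (is_RInt_unique f a u y Hy1). exact Hy2.
Qed.

Lemma RInt_pos_nonneg (a u : R) : 0 < a -> a <= u -> 0 <= RInt f a u.
Proof.
  intros Ha Hu. apply RInt_ge_0; [exact Hu|apply ex_RInt_pos; auto; lra|].
  intros x Hx; apply Rlt_le, f_pos; lra.
Qed.

Lemma Fprim_pos (u : R) : 0 < u -> 0 < Fprim f u.
Proof.
  intros Hu. rewrite (Fprim_split (u / 2) u) by lra.
  assert (0 < RInt f (u / 2) u).
  { apply RInt_gt_0; [lra| |]; intros; [apply f_pos|apply f_cont]; lra. }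
  cut (0 <= Fprim f (u / 2)); [lra|].
  apply Rnot_lt_le; intros Hn.
  destruct (Fprim_approx (u / 2) (- Fprim f (u / 2))) as [a [Ha Hab]]; try lra.
  apply Rabs_def2 in Hab. assert (0 <= RInt f a (u / 2)) by (apply RInt_pos_nonneg; lra). lra.
Qed.

Lemma Fprim_le_mult (u : R) :
  (forall x y, 0 < x -> x < y -> f x <= f y) -> 0 < u -> Fprim f u <= u * f u.
Proof.
  intros Hmono Hu. apply Rnot_lt_le; intros Hn.
  destruct (Fprim_approx u (Fprim f u - u * f u)) as [a [Ha Hab]]; try lra.
  apply Rabs_def2 in Hab.
  assert (RInt f a u <= RInt (fun _ => f u) a u).
  { apply RInt_le; [lra|apply ex_RInt_pos; auto; lra|apply ex_RInt_const|].
    intros x Hx; apply Hmono; lra. }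
  rewrite RInt_const in H. unfold scal in H; simpl in H; unfold mult in H; simpl in H.
  assert (0 < a * f u) by (apply Rmult_lt_0_compat; [lra|apply f_pos; lra]). nra.
Qed.

Lemma is_derive_Fprim (u : R) : 0 < u -> is_derive (Fprim f) u (f u).
Proof.
  intros Hu.
  apply (is_derive_ext_loc (fun t => Fprim f 1 + RInt f 1 t)).
  - exists (mkposreal u Hu); intros y Hy. apply Rabs_def2 in Hy; simpl in Hy.
    unfold minus, plus, opp in Hy; simpl in Hy. symmetry; apply Fprim_split; lra.
  - replace (f u) with (0 + f u) by ring.
    apply (is_derive_plus (V := R_NormedModule)); [apply (is_derive_const (V := R_NormedModule))|].
    apply is_derive_RInt_pos; auto; lra.
Qed.

Lemma continuous_inv_sqrt_Fprim (u : R) : 0 < u -> continuous (fun u => / sqrt (Fprim f u)) u.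
Proof.
  intros Hu. apply continuous_inv_sqrt; [|apply Fprim_pos, Hu].
  eapply is_derive_continuous, is_derive_Fprim, Hu.
Qed.

(** Take g x = 2 phi (Rmax psi x) + C: beyond X1 the asymptotics give f <= 2 phi, and C bounds f on
    [psi, X1]. Far out g <= 5 f, because f(x)/x tends to infinity and so f dominates C. Hence 1 plus
    the primitive of g is at most a constant times [Fprim f], and the integral still diverges from
    every starting point z. *)
Lemma asymp_increasing_majorant (psi : R) :
  0 < psi -> asymp_increasing f -> is_lim (fun x => f x / x) p_infty p_infty ->
  (forall eta, 0 < eta ->
      is_lim (fun X => RInt (fun u => / sqrt (Fprim f u)) eta X) p_infty p_infty) ->
  exists g : R -> R,
    (forall x, continuous g x) /\ (forall x, 0 <= g x) /\
    (forall x y, x <= y -> g x <= g y) /\ (forall x, psi <= x -> f x <= g x) /\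
    (forall z, psi <= z ->
      is_lim (fun X => RInt (fun u => / sqrt (1 + RInt g z u)) z X) p_infty p_infty).
Proof.
  intros Hpsi [phi [Hphic [Hphip [Hphim Hphil]]]] Hsup Hosg.
  assert (Hphim' : forall x y, 0 < x -> x <= y -> phi x <= phi y).
  { intros x y Hx [Hxy| ->]; [apply Hphim; lra|lra]. }
  destruct (Hphil (fun y => Rabs (y - 1) < 1 / 2)) as [X1 HX1].
  { assert (Hh : 0 < 1 / 2) by lra. exists (mkposreal _ Hh); intros y Hy; exact Hy. }
  destruct (continuous_bounded f psi X1) as [C [HC HCb]].
  { intros x Hx; apply f_cont; lra. }
  assert (Hcomp : forall x, X1 < x -> 0 < x -> f x <= 2 * phi x /\ phi x <= 2 * f x).
  { intros x Hx Hx0. specialize (HX1 x Hx). apply Rabs_def2 in HX1.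
    specialize (Hphip x Hx0).
    replace (f x) with (f x / phi x * phi x) by (field; lra). nra. }
  destruct (is_lim_p_infty_gt _ 1 Hsup) as [X2 HX2].
  set (g := fun x => 2 * phi (Rmax psi x) + C).
  assert (Hmax : forall x, 0 < Rmax psi x).
  { intros x; eapply Rlt_le_trans; [exact Hpsi|apply Rmax_l]. }
  assert (Hgc : forall x, continuous g x).
  { intros x. apply continuous_Rplus; [|apply continuous_const].
    apply continuous_Rmult; [apply continuous_const|].
    apply (continuous_comp (Rmax psi) phi); [apply continuous_Rmax_l|apply Hphic, Hmax]. }
  assert (Hg0 : forall x, 0 < g x).
  { intros x; unfold g; specialize (Hphip _ (Hmax x)); lra. }
  exists g; split; [exact Hgc|split; [intros x; apply Rlt_le, Hg0|split; [|split]]].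
  - intros x y Hxy. unfold g.
    assert (phi (Rmax psi x) <= phi (Rmax psi y)); [|lra].
    apply Hphim'; [apply Hmax|]. apply Rle_max_compat_l, Hxy.
  - intros x Hx. unfold g. rewrite Rmax_right by lra.
    assert (0 < phi x) by (apply Hphip; lra).
    destruct (Rle_dec x X1) as [Hle|Hgt].
    + specialize (HCb x (conj Hx Hle)). generalize (Rle_abs (f x)); lra.
    + destruct (Hcomp x) as [H1 _]; lra.
  - intros z Hz.
    set (X0 := Rmax z (Rmax (X1 + 1) (Rmax (X2 + 1) C))).
    assert (HX0 : z <= X0 /\ X1 < X0 /\ X2 < X0 /\ C <= X0).
    { unfold X0. generalize (Rmax_l z (Rmax (X1 + 1) (Rmax (X2 + 1) C)))
        (Rmax_r z (Rmax (X1 + 1) (Rmax (X2 + 1) C)))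
        (Rmax_l (X1 + 1) (Rmax (X2 + 1) C)) (Rmax_r (X1 + 1) (Rmax (X2 + 1) C))
        (Rmax_l (X2 + 1) C) (Rmax_r (X2 + 1) C). lra. }
    (* 2 phi <= 4 f, and C <= X0 <= x <= f x accounts for the fifth multiple. *)
    assert (Hg5 : forall x, X0 <= x -> g x <= 5 * f x).
    { intros x Hx. unfold g. rewrite Rmax_right by lra.
      destruct (Hcomp x) as [_ H2]; [lra|lra|].
      assert (1 < f x / x) by (apply HX2; lra).
      assert (x <= f x); [|lra].
      replace (f x) with (f x / x * x) by (field; lra). nra. }
    set (G := fun u => 1 + RInt g z u).
    assert (HexG : forall a b, ex_RInt g a b) by (intros; apply ex_RInt_cont, Hgc).
    assert (HG1 : forall u, z <= u -> 1 <= G u).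
    { intros u Hu; unfold G. assert (0 <= RInt g z u); [|lra].
      apply RInt_ge_0; auto. intros; apply Rlt_le, Hg0. }
    assert (HGc : forall u, continuous G u).
    { intros u. apply continuous_Rplus; [apply continuous_const|].
      apply (is_derive_continuous _ _ (g u)), is_derive_RInt_cont, Hgc. }
    assert (HFX0 := Fprim_pos X0 ltac:(lra)).
    (* K F(X0) = G(X0) + 5 F(X0) absorbs the value at X0, and K >= 5 handles the increments beyond
       it. *)
    set (K := 5 + G X0 / Fprim f X0).
    assert (HGX0 := HG1 X0 ltac:(lra)).
    assert (HK : 5 < K).
    { unfold K. assert (0 < G X0 / Fprim f X0) by (apply Rdiv_lt_0_compat; lra). lra. }
    assert (HGF : forall u, X0 <= u -> G u <= K * Fprim f u).
    { intros u Hu.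
      assert (HR : RInt g X0 u <= 5 * RInt f X0 u).
      { rewrite <- RInt_Rscal by (apply ex_RInt_pos; auto; lra).
        apply RInt_le; auto.
        - apply (ex_RInt_scal f), ex_RInt_pos; auto; lra.
        - intros x Hx; apply Hg5; lra. }
      replace (G u) with (G X0 + RInt g X0 u).
      2:{ unfold G. rewrite (RInt_split g z X0 u) by auto. ring. }
      rewrite (Fprim_split X0 u) by lra.
      assert (HRf : 0 <= RInt f X0 u) by (apply RInt_pos_nonneg; lra).
      replace (K * (Fprim f X0 + RInt f X0 u))
        with (G X0 + 5 * Fprim f X0 + K * RInt f X0 u) by (unfold K; field; lra).
      nra. }
    assert (HexG' : forall a b, z <= a -> z <= b -> ex_RInt (fun u => / sqrt (G u)) a b).
    { intros a b Ha Hb. apply (ex_RInt_continuous (V := R_CompleteNormedModule)).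
      intros u [Hu _]. apply continuous_inv_sqrt; [apply HGc|].
      apply Rlt_le_trans with 1; [lra|]. apply HG1.
      eapply Rle_trans; [|exact Hu]. apply Rmin_glb; assumption. }
    assert (HsK : 0 < sqrt K) by (apply sqrt_lt_R0; lra).
    apply is_lim_p_infty_intro; intros B.
    destruct (is_lim_p_infty_gt _ ((B - RInt (fun u => / sqrt (G u)) z X0) * sqrt K)
       (Hosg X0 ltac:(lra))) as [X3 HX3].
    exists (Rmax X0 X3); intros x Hx.
    assert (Hx' : X0 < x /\ X3 < x) by (generalize (Rmax_l X0 X3) (Rmax_r X0 X3); lra).
    specialize (HX3 x (proj2 Hx')).
    fold G. change (B < RInt (fun u => / sqrt (G u)) z x).
    rewrite (RInt_split (fun u => / sqrt (G u)) z X0 x) by (apply HexG'; lra).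
    assert (Hle : RInt (fun u => / sqrt K * / sqrt (Fprim f u)) X0 x
                  <= RInt (fun u => / sqrt (G u)) X0 x).
    { apply RInt_le; [lra| |apply HexG'; lra|].
      - apply (ex_RInt_scal (fun u => / sqrt (Fprim f u))), ex_RInt_pos; try lra.
        intros; apply continuous_inv_sqrt_Fprim; auto.
      - intros u Hu. assert (0 < Fprim f u) by (apply Fprim_pos; lra).
        rewrite <- Rinv_mult, <- sqrt_mult by lra.
        apply Rinv_le_contravar.
        + apply sqrt_lt_R0. generalize (HG1 u ltac:(lra)); lra.
        + apply sqrt_le_1_alt, HGF; lra. }
    rewrite RInt_Rscal in Hle.
    2:{ apply ex_RInt_pos; try lra. intros; apply continuous_inv_sqrt_Fprim; auto. }
    assert (B - RInt (fun u => / sqrt (G u)) z X0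
       < / sqrt K * RInt (fun u => / sqrt (Fprim f u)) X0 x); [|lra].
    apply Rmult_lt_reg_r with (sqrt K); [exact HsK|].
    rewrite (Rmult_comm (/ sqrt K)), Rmult_assoc, Rinv_l, Rmult_1_r by lra. exact HX3.
Qed.

End Potential.

(** * A priori bounds and existence for the Volterra equation *)

(** Put Z = z0 plus c times the double integral of q. Then Z'' = c q <= c g(Z) and Z'(0) = 0, so
    Z'^2 <= 2 c G(Z), and the integral of 1 / sqrt G from z0 to Z grows at rate at most sqrt (2 c).
    The constant 1 in G keeps the integrand finite at z0. Allowing any q with q <= g(Z) covers
    delayed feedback, and M is chosen before q and S. *)
Lemma osgood_bound (g : R -> R) (z0 c T : R) :
  (forall x, continuous g x) -> (forall x, 0 <= g x) -> 0 < c ->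
  is_lim (fun X => RInt (fun u => / sqrt (1 + RInt g z0 u)) z0 X) p_infty p_infty ->
  exists M, forall q S, (forall x, continuous q x) -> (forall x, 0 <= q x) ->
    0 <= S <= T ->
    (forall s, 0 <= s <= S -> q s <= g (z0 + c * RInt (RInt q 0) 0 s)) ->
    z0 + c * RInt (RInt q 0) 0 S <= M.
Proof.
  intros Hgc Hg0 Hc Hosg.
  set (G := fun u => 1 + RInt g z0 u).
  assert (HG1 : forall u, z0 <= u -> 1 <= G u).
  { intros u Hu; unfold G. assert (0 <= RInt g z0 u); [|lra].
    apply RInt_ge_0; auto. apply ex_RInt_cont, Hgc. }
  assert (HGd : forall u, is_derive G u (g u)).
  { intros u. replace (g u) with (0 + g u) by ring.
    apply (is_derive_plus (V := R_NormedModule));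
      [apply (is_derive_const (V := R_NormedModule))|apply is_derive_RInt_cont, Hgc]. }
  (* Clipped at z0, since G may fail to be positive below it. *)
  set (j := fun u => / sqrt (G (Rmax z0 u))).
  assert (Hj : forall u, continuous j u).
  { intros u. apply continuous_inv_sqrt.
    - apply (continuous_comp (Rmax z0) G); [apply continuous_Rmax_l|].
      eapply is_derive_continuous, HGd.
    - apply Rlt_le_trans with 1; [lra|]. apply HG1, Rmax_l. }
  assert (Hjp : forall u, 0 < j u).
  { intros u. apply Rinv_0_lt_compat, sqrt_lt_R0, Rlt_le_trans with 1; [lra|].
    apply HG1, Rmax_l. }
  (* Up to time T the integral of j from z0 to Z cannot exceed this level, while beyond X it
     does. *)
  destruct (is_lim_p_infty_gt _ (sqrt (2 * c) * T) Hosg) as [X HX].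
  exists (Rmax z0 X); intros q S Hqc Hq0 HS Hqg.
  assert (HVd : forall t, is_derive (RInt q 0) t (q t)) by (intros; apply is_derive_RInt_cont, Hqc).
  assert (HVc : forall t, continuous (RInt q 0) t).
  { intros t; eapply is_derive_continuous, HVd. }
  assert (HV0 : forall t, 0 <= t -> 0 <= RInt q 0 t).
  { intros t Ht; apply RInt_ge_0; auto. apply ex_RInt_cont, Hqc. }
  set (Z := fun t => z0 + c * RInt (RInt q 0) 0 t).
  assert (HZd : forall t, is_derive Z t (c * RInt q 0 t)).
  { intros t. replace (c * RInt q 0 t) with (0 + c * RInt q 0 t) by ring.
    apply (is_derive_plus (V := R_NormedModule)); [apply (is_derive_const (V := R_NormedModule))|].
    apply (is_derive_scal (fun t => RInt (RInt q 0) 0 t)), is_derive_RInt_cont, HVc. }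
  assert (HZz : forall t, 0 <= t -> z0 <= Z t).
  { intros t Ht; unfold Z. assert (0 <= RInt (RInt q 0) 0 t).
    { apply RInt_ge_0; auto; [apply ex_RInt_cont, HVc|]. intros; apply HV0; lra. }
    nra. }
  (* Energy estimate: [(2 c G(Z) - Z'^2)' = 2 Z' (c g(Z) - Z'') >= 0]. *)
  assert (Henergy : forall t, 0 <= t <= S ->
    (c * RInt q 0 t) * (c * RInt q 0 t) <= 2 * c * G (Z t)).
  { intros t Ht.
    set (D := fun t => 2 * c * G (Z t) - (c * RInt q 0 t) * (c * RInt q 0 t)).
    assert (HD : D 0 <= D t).
    { assert (HDd : forall s, is_derive D s
        (2 * c * (c * RInt q 0 s * g (Z s)) -
         ((c * q s) * (c * RInt q 0 s) + (c * RInt q 0 s) * (c * q s)))).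
      { intros s. apply (is_derive_minus (V := R_NormedModule)).
        - apply is_derive_scal, (is_derive_comp G Z); [apply HGd|apply HZd].
        - apply (is_derive_mult (fun t => c * RInt q 0 t) (fun t => c * RInt q 0 t));
            [apply is_derive_scal, HVd|apply is_derive_scal, HVd|intros; apply Rmult_comm]. }
      eapply (nondecreasing_of_derive D); [lra|intros s _; apply HDd| |].
      - intros s _; eapply is_derive_continuous, HDd.
      - intros s Hs. simpl. specialize (Hqg s ltac:(lra)). fold (Z s) in Hqg.
        specialize (HV0 s ltac:(lra)).
        assert (0 <= 2 * (c * c) * RInt q 0 s * (g (Z s) - q s)); [|lra].
        apply Rmult_le_pos; [|lra]. apply Rmult_le_pos; [nra|exact HV0]. }
    assert (0 < D 0); [|unfold D in *; lra].
    unfold D. rewrite (RInt_point (V := R_CompleteNormedModule)). unfold zero; simpl.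
    generalize (HG1 (Z 0) (HZz 0 (Rle_refl 0))); nra. }
  assert (Hquad : RInt j z0 (Z S) <= sqrt (2 * c) * S).
  { assert (H : RInt j z0 (Z S) - RInt j z0 (Z 0) <= sqrt (2 * c) * S - sqrt (2 * c) * 0).
    { assert (Hd1 : forall t, is_derive (fun t => RInt j z0 (Z t)) t (c * RInt q 0 t * j (Z t))).
      { intros t. apply (is_derive_comp (fun u => RInt j z0 u) Z); [|apply HZd].
        apply is_derive_RInt_cont, Hj. }
      assert (Hd2 : forall t, is_derive (fun t => sqrt (2 * c) * t) t (sqrt (2 * c)))
        by (intros; apply is_derive_linear).
      apply (derive_le _ _ _ _ 0 S (proj1 HS) (fun t _ => Hd1 t) (fun t _ => Hd2 t)).
      - intros t _; eapply is_derive_continuous, Hd1.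
      - intros t _; eapply is_derive_continuous, Hd2.
      - intros t Ht. unfold j.
        assert (HZt := HZz t ltac:(lra)). rewrite Rmax_right by exact HZt.
        assert (HGZ := HG1 _ HZt).
        assert (Hs : 0 < sqrt (G (Z t))) by (apply sqrt_lt_R0; lra).
        apply Rmult_le_reg_r with (sqrt (G (Z t))); [exact Hs|].
        rewrite Rmult_assoc, Rinv_l, Rmult_1_r, <- sqrt_mult by lra.
        rewrite <- (sqrt_square (c * RInt q 0 t)).
        + apply sqrt_le_1_alt, Henergy; lra.
        + apply Rmult_le_pos; [lra|apply HV0; lra]. }
    replace (Z 0) with z0 in H.
    - rewrite (RInt_point (V := R_CompleteNormedModule)) in H. unfold zero in H; simpl in H; lra.
    - unfold Z. rewrite (RInt_point (V := R_CompleteNormedModule)). unfold zero; simpl; ring. }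
  fold (Z S). apply Rnot_lt_le; intros Hlt.
  assert (HZS : z0 <= Z S /\ X < Z S) by (generalize (Rmax_l z0 X) (Rmax_r z0 X); lra).
  specialize (HX (Z S) (proj2 HZS)).
  rewrite (RInt_ext _ j) in HX.
  2:{ intros u Hu. rewrite Rmin_left in Hu by lra. unfold j. rewrite Rmax_right by lra. reflexivity. }
  assert (sqrt (2 * c) * S <= sqrt (2 * c) * T); [|lra].
  apply Rmult_le_compat_l; [apply sqrt_pos|lra].
Qed.

(** * The integrated equation, its delayed approximations and their limit *)

Definition volterra (k h : R -> R) (psi : R) (u : R -> R) (t : R) : R :=
  psi + RInt (fun r => h r + conv k u r) 0 t.

Section Volterra.
Context (k h : R -> R)
  (k_cont : forall x, continuous k x) (h_cont : forall x, continuous h x).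

Lemma continuous_source (u : R -> R) (t : R) :
  (forall x, continuous u x) -> continuous (fun r => h r + conv k u r) t.
Proof. intros Hu. apply continuous_Rplus; [apply h_cont|apply continuous_conv; auto]. Qed.

Lemma is_derive_volterra (psi : R) (u : R -> R) (t : R) :
  (forall x, continuous u x) -> is_derive (volterra k h psi u) t (h t + conv k u t).
Proof.
  intros Hu. replace (h t + conv k u t) with (0 + (h t + conv k u t)) by ring.
  apply (is_derive_plus (V := R_NormedModule)); [apply (is_derive_const (V := R_NormedModule))|].
  apply (is_derive_RInt_cont (fun r => h r + conv k u r)).
  intros; apply continuous_source; auto.
Qed.

Lemma volterra_0 (psi : R) (u : R -> R) : volterra k h psi u 0 = psi.
Proof.
  unfold volterra. rewrite (RInt_point (V := R_CompleteNormedModule)). unfold zero; simpl; ring.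
Qed.

Lemma volterra_split (psi : R) (u : R -> R) (t : R) :
  (forall x, continuous u x) ->
  volterra k h psi u t = psi + Hint h t + RInt (conv k u) 0 t.
Proof.
  intros Hu. unfold volterra, Hint.
  rewrite (RInt_Rplus h (conv k u)); [ring|apply ex_RInt_cont; auto|].
  apply ex_RInt_cont; intros; apply continuous_conv; auto.
Qed.

Lemma conv_ext (u v : R -> R) (t : R) :
  0 <= t -> (forall s, 0 < s < t -> u s = v s) -> conv k u t = conv k v t.
Proof.
  intros Ht Huv. apply RInt_ext; intros s Hs.
  rewrite Rmin_left, Rmax_right in Hs by exact Ht. rewrite Huv by exact Hs. reflexivity.
Qed.

Lemma volterra_ext (psi : R) (u v : R -> R) (t : R) :
  0 <= t -> (forall s, 0 < s < t -> u s = v s) ->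
  volterra k h psi u t = volterra k h psi v t.
Proof.
  intros Ht Huv. unfold volterra; f_equal. apply RInt_ext; intros r Hr.
  rewrite Rmin_left, Rmax_right in Hr by exact Ht.
  rewrite (conv_ext u v r); [reflexivity|lra|]. intros; apply Huv; lra.
Qed.

Context (k_pos : forall x, 0 <= k x).

Lemma ex_RInt_conv (u : R -> R) (a b t : R) :
  (forall x, continuous u x) -> ex_RInt (fun s => k (t - s) * u s) a b.
Proof. intros Hu; apply ex_RInt_cont; intros; apply continuous_conv_integrand; auto. Qed.

Lemma conv_nonneg (u : R -> R) (t : R) :
  (forall x, continuous u x) -> 0 <= t -> (forall s, 0 < s < t -> 0 <= u s) ->
  0 <= conv k u t.
Proof.
  intros Hu Ht Hp. apply RInt_ge_0; [exact Ht|apply ex_RInt_conv, Hu|].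
  intros s Hs; apply Rmult_le_pos; auto.
Qed.

Lemma conv_le (u v : R -> R) (t : R) :
  (forall x, continuous u x) -> (forall x, continuous v x) -> 0 <= t ->
  (forall s, 0 < s < t -> u s <= v s) -> conv k u t <= conv k v t.
Proof.
  intros Hu Hv Ht Hp. apply RInt_le; [exact Ht|apply ex_RInt_conv, Hu|apply ex_RInt_conv, Hv|].
  intros s Hs; apply Rmult_le_compat_l; auto.
Qed.

Context (F g : R -> R) (psi : R)
  (F_cont : forall x, continuous F x) (F_pos : forall x, 0 <= F x)
  (H_pos : forall t, 0 <= t -> 0 <= Hint h t)
  (g_cont : forall x, continuous g x) (g_pos : forall x, 0 <= g x)
  (g_mono : forall x y, x <= y -> g x <= g y)
  (F_le_g : forall x, psi <= x -> F x <= g x)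
  (g_osgood : forall z, psi <= z ->
    is_lim (fun X => RInt (fun u => / sqrt (1 + RInt g z u)) z X) p_infty p_infty).

(** Before time d the history is frozen at [x 0]. At times s >= 0, d = 0 gives the undelayed
    feedback, so the bounds below serve both the approximations and genuine solutions. *)
Definition delayed (d : R) (x : R -> R) (s : R) : R := F (x (Rmax 0 (s - d))).

Lemma continuous_delayed (d : R) (x : R -> R) (s : R) :
  (forall t, continuous x t) -> continuous (delayed d x) s.
Proof.
  intros Hx. apply (continuous_comp (fun s => x (Rmax 0 (s - d))) F); [|apply F_cont].
  apply (continuous_comp (fun s => Rmax 0 (s - d)) x); [|apply Hx].
  apply (continuous_comp (fun s => s - d) (Rmax 0)); [|apply continuous_Rmax_l].
  apply continuous_Rminus; [apply continuous_id|apply continuous_const].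
Qed.

(** With k <= W and H <= B on [0, T], x lies below Z = psi + B plus W times the double integral of
    q. The delay does no harm because Z and g are nondecreasing: F (x (s - d)) <= g (Z (s - d)) <= g
    (Z s), which is the hypothesis of [osgood_bound]. The lower bound psi <= x is what makes
    [F_le_g] applicable. *)
Lemma delayed_bound (T : R) :
  exists M, forall x d S, (forall t, continuous x t) -> 0 <= d -> S <= T ->
    (forall t, 0 <= t <= S -> x t = volterra k h psi (delayed d x) t) ->
    forall t, 0 <= t <= S -> psi <= x t <= M.
Proof.
  destruct (continuous_bounded k 0 T) as [W [HW HWb]]; [auto|].
  destruct (continuous_bounded (Hint h) 0 T) as [B [HB HBb]].
  { intros t _. eapply is_derive_continuous, is_derive_RInt_cont, h_cont. }
  destruct (osgood_bound g (psi + B) W T g_cont g_pos HW) as [M HM].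
  { apply g_osgood; lra. }
  exists M; intros x d S Hx Hd HST Heq.
  set (q := delayed d x) in *.
  assert (Hqc : forall s, continuous q s) by (intros; apply continuous_delayed, Hx).
  assert (Hq0 : forall s, 0 <= q s) by (intros; apply F_pos).
  assert (HVc : forall t, continuous (RInt q 0) t).
  { intros t; eapply is_derive_continuous, is_derive_RInt_cont, Hqc. }
  assert (HV0 : forall t, 0 <= t -> 0 <= RInt q 0 t).
  { intros t Ht; apply RInt_ge_0; auto. apply ex_RInt_cont, Hqc. }
  assert (Hcc : forall t, continuous (conv k q) t) by (intros; apply continuous_conv; auto).
  set (Z := fun t => psi + B + W * RInt (RInt q 0) 0 t).
  assert (Hlow : forall t, 0 <= t <= S -> psi <= x t).
  { intros t Ht. rewrite Heq, volterra_split by auto.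
    assert (0 <= RInt (conv k q) 0 t).
    { apply RInt_ge_0; [lra|apply ex_RInt_cont, Hcc|].
      intros; apply conv_nonneg; auto; lra. }
    specialize (H_pos t (proj1 Ht)); lra. }
  assert (Hup : forall t, 0 <= t <= S -> x t <= Z t).
  { intros t Ht. rewrite Heq, volterra_split by auto. unfold Z.
    assert (Hint h t <= B).
    { eapply Rle_trans; [apply Rle_abs|]; apply HBb; lra. }
    assert (RInt (conv k q) 0 t <= RInt (fun r => W * RInt q 0 r) 0 t); [|
      rewrite (RInt_Rscal (RInt q 0)) in * by (apply ex_RInt_cont, HVc); lra].
    apply RInt_le; [lra|apply ex_RInt_cont, Hcc| |].
    { apply (ex_RInt_scal (RInt q 0)), ex_RInt_cont, HVc. }
    intros r Hr. rewrite <- RInt_Rscal by (apply ex_RInt_cont, Hqc).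
    apply RInt_le; [lra|apply ex_RInt_conv, Hqc| |].
    { apply (ex_RInt_scal q), ex_RInt_cont, Hqc. }
    intros s Hs. apply Rmult_le_compat_r; [apply Hq0|].
    eapply Rle_trans; [apply Rle_abs|]; apply HWb; lra. }
  assert (HZm : forall a b, 0 <= a -> a <= b -> Z a <= Z b).
  { intros a b Ha Hab. unfold Z.
    rewrite (RInt_split (RInt q 0) 0 a b) by (apply ex_RInt_cont, HVc).
    assert (0 <= RInt (RInt q 0) a b).
    { apply RInt_ge_0; [exact Hab|apply ex_RInt_cont, HVc|]. intros; apply HV0; lra. }
    nra. }
  intros t Ht; split; [apply Hlow, Ht|].
  apply Rle_trans with (Z t); [apply Hup, Ht|]. apply HM; auto; [lra|].
  intros s Hs. fold (Z s). unfold q, delayed.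
  assert (Hs' : 0 <= Rmax 0 (s - d) <= s).
  { split; [apply Rmax_l|]. apply Rmax_lub; lra. }
  eapply Rle_trans; [apply F_le_g, Hlow; lra|].
  apply g_mono. eapply Rle_trans; [apply Hup; lra|]. apply HZm; lra.
Qed.

Lemma delayed_lipschitz (T : R) :
  exists L, 0 < L /\ forall x d S, (forall t, continuous x t) -> 0 <= d -> S <= T ->
    (forall t, 0 <= t <= S -> x t = volterra k h psi (delayed d x) t) ->
    forall s t, 0 <= s <= S -> 0 <= t <= S -> Rabs (x t - x s) <= L * Rabs (t - s).
Proof.
  destruct (delayed_bound T) as [M HM].
  destruct (continuous_bounded k 0 T) as [W [HW HWb]]; [auto|].
  destruct (continuous_bounded h 0 T) as [B [HB HBb]]; [auto|].
  destruct (continuous_bounded F psi M) as [A [HA HAb]]; [auto|].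
  exists (B + Rabs T * (W * A)); split.
  { assert (0 <= Rabs T * (W * A)); [|lra].
    apply Rmult_le_pos; [apply Rabs_pos|apply Rmult_le_pos; lra]. }
  intros x d S Hx Hd HST Heq s t Hs Ht.
  assert (HM' := HM x d S Hx Hd HST Heq).
  set (q := delayed d x) in *.
  assert (Hqc : forall s, continuous q s) by (intros; apply continuous_delayed, Hx).
  rewrite (Heq s Hs), (Heq t Ht). unfold volterra.
  assert (Hex : forall a b, ex_RInt (fun r => h r + conv k q r) a b).
  { intros; apply ex_RInt_cont; intros; apply continuous_source; auto. }
  rewrite (RInt_split _ 0 s t) by auto.
  assert (Hcancel : forall a b : R, psi + (a + b) - (psi + a) = b) by (intros; ring).
  rewrite Hcancel.
  rewrite Rmult_comm. apply RInt_abs_le; [auto|]. intros r Hr.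
  assert (Hr' : 0 <= r <= S).
  { generalize (Rmin_glb s t 0), (Rmax_lub s t S); lra. }
  eapply Rle_trans; [apply Rabs_triang|]. apply Rplus_le_compat; [apply HBb; lra|].
  apply Rle_trans with (Rabs (r - 0) * (W * A)).
  - apply RInt_abs_le; [apply ex_RInt_conv, Hqc|]. intros v Hv.
    rewrite Rmin_left, Rmax_right in Hv by lra.
    rewrite Rabs_mult. apply Rmult_le_compat; try apply Rabs_pos; [apply HWb; lra|].
    apply HAb, HM'. split; [apply Rmax_l|]. apply Rmax_lub; lra.
  - apply Rmult_le_compat_r; [apply Rmult_le_pos; lra|].
    rewrite Rminus_0_r, !Rabs_pos_eq by lra. lra.
Qed.

(** Method of steps: the right side at time t sees the previous iterate only up to t - d, so each
    iteration extends by d the interval on which the iterates no longer change. *)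
Lemma delayed_exists (d T : R) : 0 < d ->
  exists x, (forall t, continuous x t) /\
    forall t, 0 <= t <= T -> x t = volterra k h psi (delayed d x) t.
Proof.
  intros Hd.
  set (X := fix X (n : nat) : R -> R :=
    match n with O => fun _ => psi | S n => volterra k h psi (delayed d (X n)) end).
  assert (HXc : forall n t, continuous (X n) t).
  { induction n as [|n IH]; intros t; [apply continuous_const|].
    eapply is_derive_continuous, is_derive_volterra.
    intros; apply continuous_delayed, IH. }
  assert (Hstab : forall n t, 0 <= t <= INR n * d -> X n t = X (S n) t).
  { induction n as [|n IH]; intros t Ht.
    - simpl in Ht. replace t with 0 by lra. symmetry; apply volterra_0.
    - rewrite S_INR in Ht. apply volterra_ext; [lra|]. intros s Hs.
      unfold delayed; f_equal. apply IH. split; [apply Rmax_l|].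
      apply Rmax_lub; [|lra]. apply Rmult_le_pos; [apply pos_INR|lra]. }
  destruct (nfloor_ex (Rmax 0 (T / d)) (Rmax_l _ _)) as [n [_ Hn]].
  assert (HT : T <= INR (S n) * d).
  { rewrite S_INR. replace T with (T / d * d) by (field; lra).
    apply Rmult_le_compat_r; [lra|]. generalize (Rmax_r 0 (T / d)); lra. }
  exists (X (S n)); split; [apply HXc|]. intros t Ht. rewrite Hstab by lra. reflexivity.
Qed.

Lemma conv_close (u v : R -> R) (e W r : R) :
  (forall x, continuous u x) -> (forall x, continuous v x) -> 0 <= r ->
  (forall s, 0 <= s <= r -> k s <= W) -> (forall s, 0 <= s <= r -> Rabs (u s - v s) <= e) ->
  Rabs (conv k u r - conv k v r) <= r * (W * e).
Proof.
  intros Hu Hv Hr HW He. unfold conv.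
  rewrite <- (RInt_Rminus (fun s => k (r - s) * u s) (fun s => k (r - s) * v s))
    by (apply ex_RInt_conv; auto).
  replace (r * (W * e)) with (Rabs (r - 0) * (W * e)) by (rewrite Rminus_0_r, Rabs_pos_eq; lra).
  apply RInt_abs_le.
  { apply (ex_RInt_minus (fun s => k (r - s) * u s) (fun s => k (r - s) * v s));
      apply ex_RInt_conv; auto. }
  intros s Hs. rewrite Rmin_left, Rmax_right in Hs by lra.
  replace (k (r - s) * u s - k (r - s) * v s) with (k (r - s) * (u s - v s)) by ring.
  rewrite Rabs_mult, (Rabs_pos_eq (k (r - s))) by auto.
  apply Rmult_le_compat; [auto|apply Rabs_pos|apply HW; lra|apply He; lra].
Qed.

Lemma volterra_close (u v : R -> R) (e W T t : R) :
  (forall x, continuous u x) -> (forall x, continuous v x) -> 0 <= t <= T ->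
  (forall s, 0 <= s <= T -> k s <= W) -> (forall s, 0 <= s <= T -> Rabs (u s - v s) <= e) ->
  Rabs (volterra k h psi u t - volterra k h psi v t) <= T * (T * (W * e)).
Proof.
  intros Hu Hv Ht HW He. rewrite !volterra_split by assumption.
  assert (Hcu : forall r, continuous (conv k u) r) by (intros; apply continuous_conv; auto).
  assert (Hcv : forall r, continuous (conv k v) r) by (intros; apply continuous_conv; auto).
  assert (HWe : 0 <= W * e).
  { apply Rmult_le_pos.
    - eapply Rle_trans; [apply (k_pos t)|apply HW, Ht].
    - eapply Rle_trans; [apply Rabs_pos|apply (He t), Ht]. }
  replace (psi + Hint h t + RInt (conv k u) 0 t - (psi + Hint h t + RInt (conv k v) 0 t))
    with (RInt (fun r => conv k u r - conv k v r) 0 t)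
    by (rewrite (RInt_Rminus (conv k u) (conv k v)) by (apply ex_RInt_cont; auto); simpl; ring).
  apply Rle_trans with (Rabs (t - 0) * (T * (W * e))).
  - apply RInt_abs_le.
    { apply (ex_RInt_minus (conv k u) (conv k v)); apply ex_RInt_cont; auto. }
    intros r Hr. rewrite Rmin_left, Rmax_right in Hr by lra.
    apply Rle_trans with (r * (W * e)).
    + apply conv_close; auto; [lra| |]; intros s Hs; [apply HW|apply He]; lra.
    + apply Rmult_le_compat_r; lra.
  - rewrite Rminus_0_r, Rabs_pos_eq by lra.
    apply Rmult_le_compat_r; [apply Rmult_le_pos|]; lra.
Qed.

(** The approximation z n has delay 1 / (n + 1) and solves its equation only up to time n. On a
    given [0, T] this covers all large n, which is why [arzela_ascoli] asks for the Lipschitz bound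
    only from some index on. *)
Lemma volterra_exists :
  exists x, (forall t, continuous x t) /\
    forall t, 0 <= t -> x t = volterra k h psi (fun s => F (x s)) t.
Proof.
  destruct (functional_choice (fun (n : nat) x => (forall t, continuous x t) /\
    forall t, 0 <= t <= INR n -> x t = volterra k h psi (delayed (/ INR (S n)) x) t)) as [z Hz].
  { intros n. apply delayed_exists, Rinv_0_lt_compat, lt_0_INR; lia. }
  assert (Hd : forall n, 0 <= / INR (S n)).
  { intros n; apply Rlt_le, Rinv_0_lt_compat, lt_0_INR; lia. }
  assert (Hlip : forall T, exists N L, 0 < L /\ forall n, (N <= n)%nat ->
     forall s t, 0 <= s <= T -> 0 <= t <= T -> Rabs (z n t - z n s) <= L * Rabs (t - s)).
  { intros T. destruct (delayed_lipschitz T) as [L [HL HL']].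
    destruct (nfloor_ex (Rmax 0 T) (Rmax_l _ _)) as [N [_ HN]].
    exists (S N), L; split; [exact HL|]. intros n Hn s t Hs Ht.
    apply (HL' (z n) (/ INR (S n)) T); auto; [apply Hz|lra|].
    intros r Hr. apply Hz. apply le_INR in Hn. rewrite S_INR in Hn.
    generalize (Rmax_r 0 T); lra. }
  destruct (arzela_ascoli z psi) as [x Hx]; [|exact Hlip|].
  { intros n. rewrite (proj2 (Hz n)), volterra_0; [reflexivity|].
    split; [lra|apply pos_INR]. }
  assert (Hxlip : forall T, exists L, 0 < L /\ forall s t, 0 <= s <= T -> 0 <= t <= T ->
     Rabs (x t - x s) <= L * Rabs (t - s)).
  { intros T. destruct (Hlip T) as [N [L [HL HNL]]]. exists L; split; [exact HL|].
    intros s t Hs Ht. apply Rle_plus_epsilon; intros e He.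
    destruct (Hx T (e / 2) N) as [n [Hn1 Hn2]]; [lra|].
    specialize (HNL n Hn1 s t Hs Ht).
    assert (H1 := Hn2 s Hs). assert (H2 := Hn2 t Ht). rewrite Rabs_minus_sym in H2.
    replace (x t - x s) with ((x t - z n t) + ((z n t - z n s) + (z n s - x s))) by ring.
    eapply Rle_trans; [apply Rabs_triang|].
    generalize (Rabs_triang (z n t - z n s) (z n s - x s)). lra. }
  set (y := fun t => x (Rmax 0 t)).
  assert (Hyx : forall t, 0 <= t -> y t = x t).
  { intros t Ht; unfold y; rewrite Rmax_right by exact Ht; reflexivity. }
  assert (Hyc : forall t, continuous y t).
  { intros t. destruct (Hxlip (Rmax 0 t + 1)) as [L [HL HL']].
    apply continuous_eps; intros e He.
    assert (HeL : 0 < e / L) by (apply Rdiv_lt_0_compat; lra).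
    destruct (proj1 (continuous_eps _ _) (continuous_Rmax_l 0 t) (Rmin 1 (e / L)))
      as [d [Hd0 Hd']]; [apply Rmin_glb_lt; lra|].
    exists d; split; [exact Hd0|]. intros r Hr. specialize (Hd' r Hr).
    assert (H1 : Rabs (Rmax 0 r - Rmax 0 t) < 1)
      by (eapply Rlt_le_trans; [exact Hd'|apply Rmin_l]).
    assert (H2 : Rabs (Rmax 0 r - Rmax 0 t) < e / L)
      by (eapply Rlt_le_trans; [exact Hd'|apply Rmin_r]).
    apply Rabs_def2 in H1.
    eapply Rle_lt_trans.
    - apply HL'; (split; [apply Rmax_l|lra]).
    - replace e with (L * (e / L)) by (field; lra). apply Rmult_lt_compat_l; assumption. }
  exists y; split; [exact Hyc|]. intros T HT.
  destruct (delayed_bound T) as [M HM].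
  destruct (continuous_bounded k 0 T) as [W [HW HWb]]; [auto|].
  destruct (Hlip T) as [N1 [L [HL HNL]]].
  destruct (nfloor_ex T HT) as [N2 [_ HN2]].
  apply Rminus_diag_uniq, Rabs_eq_0, Rle_antisym; [|apply Rabs_pos].
  apply Rle_plus_epsilon; intros e He. rewrite Rplus_0_l.
  assert (HTW : 0 <= T * (T * W)).
  { repeat apply Rmult_le_pos; lra. }
  (* Feedbacks within e1 of each other give right sides within T^2 W e1 <= e / 2; the 1 keeps the
     denominator positive when T = 0. *)
  set (e1 := e / (2 * (T * (T * W) + 1))).
  assert (He1 : 0 < e1) by (apply Rdiv_lt_0_compat; lra).
  (* z n takes values in [psi, M] and y stays within 1 of it. The delay moves z n by less than eta /
     2 and the limit differs from it by at most eta / 3. *)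
  destruct (continuous_uniform F (psi - 1) (M + 1) e1 He1) as [eta [Heta HF]]; [auto|].
  destruct (exists_inv_INR_lt (eta / (2 * L))) as [N3 HN3].
  { apply Rdiv_lt_0_compat; lra. }
  destruct (Hx T (Rmin 1 (Rmin (eta / 3) (e / 2))) (max (S N2) (max N1 N3))) as [n [Hn1 Hn2]].
  { repeat apply Rmin_glb_lt; lra. }
  assert (HTn : T <= INR n).
  { assert (Hn : (S N2 <= n)%nat) by lia. apply le_INR in Hn. rewrite S_INR in Hn. lra. }
  destruct (Hz n) as [Hzc Hzeq].
  assert (Hzeq' : forall t, 0 <= t <= T -> z n t = volterra k h psi (delayed (/ INR (S n)) (z n)) t).
  { intros t Ht; apply Hzeq; lra. }
  assert (Hzb := HM (z n) _ T Hzc (Hd n) (Rle_refl T) Hzeq').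
  assert (Hclose : forall t, 0 <= t <= T ->
    Rabs (z n t - y t) <= 1 /\ Rabs (z n t - y t) <= eta / 3 /\ Rabs (z n t - y t) <= e / 2).
  { intros t Ht. rewrite Hyx by lra. specialize (Hn2 t Ht).
    generalize (Rmin_l 1 (Rmin (eta / 3) (e / 2))) (Rmin_r 1 (Rmin (eta / 3) (e / 2)))
      (Rmin_l (eta / 3) (e / 2)) (Rmin_r (eta / 3) (e / 2)). lra. }
  assert (Hq : Rabs (volterra k h psi (delayed (/ INR (S n)) (z n)) T
      - volterra k h psi (fun s => F (y s)) T) <= T * (T * (W * e1))).
  { apply volterra_close; auto.
    - intros; apply continuous_delayed, Hzc.
    - intros; apply (continuous_comp y F); auto.
    - lra.
    - intros s Hs. eapply Rle_trans; [apply Rle_abs|apply HWb, Hs].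
    - intros s Hs. apply Rlt_le. unfold delayed.
      set (r := Rmax 0 (s - / INR (S n))).
      assert (Hr : 0 <= r <= s /\ s - r <= / INR (S n)).
      { unfold r. specialize (Hd n). split; [split; [apply Rmax_l|apply Rmax_lub; lra]|].
        generalize (Rmax_r 0 (s - / INR (S n))); lra. }
      assert (H1 : Rabs (z n r - z n s) < eta / 2).
      { eapply Rle_lt_trans; [apply HNL; [lia|lra|lra]|].
        replace (eta / 2) with (L * (eta / (2 * L))) by (field; lra).
        apply Rmult_lt_compat_l; [exact HL|].
        rewrite Rabs_minus_sym, Rabs_pos_eq by lra.
        eapply Rle_lt_trans; [apply Hr|apply HN3; lia]. }
      destruct (Hclose s Hs) as [H2 [H3 _]].
      assert (H4 := Hzb s Hs). assert (H5 := Hzb r ltac:(lra)).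
      apply HF; [lra| |].
      + apply Rabs_le_between' in H2. lra.
      + replace (z n r - y s) with ((z n r - z n s) + (z n s - y s)) by ring.
        eapply Rle_lt_trans; [apply Rabs_triang|]. lra. }
  destruct (Hclose T ltac:(lra)) as [_ [_ H3]].
  rewrite Hzeq' in H3 by lra. rewrite Rabs_minus_sym in H3.
  replace (y T - volterra k h psi (fun s => F (y s)) T) with
    ((y T - volterra k h psi (delayed (/ INR (S n)) (z n)) T) +
     (volterra k h psi (delayed (/ INR (S n)) (z n)) T - volterra k h psi (fun s => F (y s)) T))
    by ring.
  eapply Rle_trans; [apply Rabs_triang|].
  assert (H4 : T * (T * (W * e1)) <= e / 2); [|lra].
  replace (T * (T * (W * e1))) with (T * (T * W) * e1) by ring.
  replace (e / 2) with ((T * (T * W) + 1) * e1) by (unfold e1; field; lra).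
  apply Rmult_le_compat_r; lra.
Qed.

End Volterra.

(** * Positivity, existence and boundedness of solutions *)

Lemma Rbar_le_lt_trans_real (s t : R) (T : Rbar) : s <= t -> Rbar_lt t T -> Rbar_lt s T.
Proof. exact (Rbar_le_lt_trans s t T). Qed.

Section Solutions.
Context (f w h : R -> R) (psi : R)
  (f_cont : forall x, 0 < x -> continuous f x)
  (f_pos : forall x, 0 < x -> 0 < f x)
  (w_cont : forall x, 0 <= x ->
      filterlim w (within (fun s => 0 <= s) (locally x)) (locally (w x)))
  (w_nonneg : forall x, 0 <= x -> 0 <= w x)
  (h_cont : forall x, continuous h x)
  (H_pos : forall t, 0 <= t -> 0 <= Hint h t)
  (psi_pos : 0 < psi).

(* Clipping makes the kernel and the force continuous on all of R; it changes nothing on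
   solutions, which stay above [psi]. *)
Definition kernel (t : R) : R := w (Rmax 0 t).
Definition force (c x : R) : R := f (Rmax c x).

Lemma continuous_kernel (t : R) : continuous kernel t.
Proof. apply continuous_clip, w_cont, Rmax_l. Qed.

Lemma kernel_nonneg (t : R) : 0 <= kernel t.
Proof. apply w_nonneg, Rmax_l. Qed.

Lemma continuous_force (c x : R) : 0 < c -> continuous (force c) x.
Proof.
  intros Hc. apply (continuous_comp (Rmax c) f); [apply continuous_Rmax_l|].
  apply f_cont. eapply Rlt_le_trans; [exact Hc|apply Rmax_l].
Qed.

Lemma force_pos (c x : R) : 0 < c -> 0 < force c x.
Proof. intros Hc. apply f_pos. eapply Rlt_le_trans; [exact Hc|apply Rmax_l]. Qed.

(** A solution is controlled only on [0, T); freezing it outside [0, S] with S < T yields a function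
    continuous on all of R. *)
Definition restrict (S : R) (x : R -> R) (t : R) : R := x (Rmax 0 (Rmin S t)).

Lemma restrict_eq (S : R) (x : R -> R) (t : R) : 0 <= t <= S -> restrict S x t = x t.
Proof. intros Ht. unfold restrict. rewrite Rmin_right, Rmax_right by lra. reflexivity. Qed.

Lemma continuous_restrict (T : Rbar) (x : R -> R) (S t : R) :
  is_solution f w h psi T x -> 0 <= S -> Rbar_lt S T -> continuous (restrict S x) t.
Proof.
  intros [_ [Hc _]] HS HST.
  apply (continuous_comp (Rmin S) (fun t => x (Rmax 0 t))); [apply continuous_Rmin_l|].
  apply continuous_clip, Hc; [apply Rmax_l|].
  apply Rbar_le_lt_trans_real with S; [|exact HST]. apply Rmax_lub; [exact HS|apply Rmin_l].
Qed.

(** The clipped force agrees with [f] only above c, so a lower bound before S is assumed. The free c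
    allows the use with psi / 2, before psi <= x is known. *)
Lemma solution_volterra_until (T : Rbar) (x : R -> R) (S c : R) :
  is_solution f w h psi T x -> 0 <= S -> Rbar_lt S T -> 0 < c ->
  (forall s, 0 <= s < S -> c <= x s) ->
  forall t, 0 <= t <= S ->
    x t = volterra kernel h psi (fun s => force c (restrict S x s)) t.
Proof.
  intros Hsol HS HST Hc Hxc t Ht.
  assert (Hrc : forall s, continuous (restrict S x) s)
    by (intros; eapply continuous_restrict; eauto).
  set (u := fun s => force c (restrict S x s)).
  assert (Huc : forall s, continuous u s).
  { intros s. apply (continuous_comp (restrict S x) (force c)); [apply Hrc|].
    apply continuous_force, Hc. }
  assert (Hvd := fun r => is_derive_volterra kernel h continuous_kernel h_cont psi u r Huc).
  assert (Hx0 : x 0 = psi) by apply Hsol.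
  assert (H : restrict S x t - restrict S x 0
    = volterra kernel h psi u t - volterra kernel h psi u 0).
  { apply (derive_eq _ _ (fun r => h r + conv kernel u r)); [lra| |auto|auto|].
    - intros r Hr.
      assert (Hpos : 0 < Rmin r (S - r)) by (apply Rmin_glb_lt; lra).
      apply (is_derive_ext_loc x).
      { exists (mkposreal _ Hpos); intros v Hv. apply Rabs_def2 in Hv; simpl in Hv.
        unfold minus, plus, opp in Hv; simpl in Hv.
        symmetry; apply restrict_eq.
        generalize (Rmin_l r (S - r)) (Rmin_r r (S - r)); lra. }
      replace (h r + conv kernel u r) with (h r + RInt (fun s => w (r - s) * f (x s)) 0 r).
      { apply Hsol; [lra|]. apply Rbar_le_lt_trans_real with S; [lra|exact HST]. }
      f_equal. apply RInt_ext. intros s Hs. rewrite Rmin_left, Rmax_right in Hs by lra.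
      unfold kernel, u, force. rewrite restrict_eq by lra.
      rewrite !Rmax_right by (try apply Hxc; lra). reflexivity.
    - intros r _. eapply is_derive_continuous, Hvd. }
  rewrite volterra_0, !restrict_eq in H by lra. lra.
Qed.

(** A bootstrap: x >= psi / 2 before a time t makes the memory term nonnegative, so x t >= psi + H t
    >= psi. The gap between psi / 2 and psi is the strict inequality that [continuous_positivity]
    propagates. *)
Lemma solution_ge (T : Rbar) (x : R -> R) :
  is_solution f w h psi T x -> forall t, 0 <= t -> Rbar_lt t T -> psi <= x t.
Proof.
  intros Hsol.
  assert (Hstep : forall S c, 0 <= S -> Rbar_lt S T -> 0 < c ->
    (forall s, 0 <= s < S -> c <= x s) -> psi <= x S).
  { intros S c HS HST Hc Hxc.
    assert (Huc : forall s, continuous (fun s => force c (restrict S x s)) s).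
    { intros s. apply (continuous_comp (restrict S x) (force c)).
      - eapply continuous_restrict; eauto.
      - apply continuous_force, Hc. }
    rewrite (solution_volterra_until T x S c Hsol HS HST Hc Hxc S) by lra.
    rewrite volterra_split by (auto using continuous_kernel).
    assert (0 <= RInt (conv kernel (fun s => force c (restrict S x s))) 0 S).
    { apply RInt_ge_0; [exact HS| |].
      - apply ex_RInt_cont; intros; apply continuous_conv; auto using continuous_kernel.
      - intros r Hr. apply conv_nonneg; auto using continuous_kernel, kernel_nonneg; [lra|].
        intros; apply Rlt_le, force_pos, Hc. }
    specialize (H_pos S HS). lra. }
  intros S HS HST. apply (Hstep S (psi / 2)); [exact HS|exact HST|lra|].
  assert (Hx0 : x 0 = psi) by apply Hsol.
  assert (Hall : forall t, 0 <= t -> 0 < restrict S x t - psi / 2).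
  { apply continuous_positivity.
    - intros t _. apply continuous_Rminus; [|apply continuous_const].
      eapply continuous_restrict; eauto.
    - rewrite restrict_eq by lra. lra.
    - intros t Ht Hbelow. destruct (Rle_dec t S) as [Hle|Hgt].
      + rewrite restrict_eq by lra.
        assert (psi <= x t); [|lra]. apply (Hstep t (psi / 2)); [lra| |lra|].
        * apply Rbar_le_lt_trans_real with S; assumption.
        * intros s Hs. specialize (Hbelow s Hs). rewrite restrict_eq in Hbelow by lra. lra.
      + specialize (Hbelow S ltac:(lra)). unfold restrict in *.
        rewrite Rmin_left by lra. rewrite Rmin_left in Hbelow by lra. exact Hbelow. }
  intros s Hs. specialize (Hall s (proj1 Hs)). rewrite restrict_eq in Hall by lra. lra.
Qed.

Lemma solution_volterra (T : Rbar) (x : R -> R) (S : R) :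
  is_solution f w h psi T x -> 0 <= S -> Rbar_lt S T ->
  forall t, 0 <= t <= S ->
    x t = volterra kernel h psi (fun s => force psi (restrict S x s)) t.
Proof.
  intros Hsol HS HST. apply (solution_volterra_until T); auto.
  intros s Hs. eapply solution_ge; [exact Hsol|lra|].
  apply Rbar_le_lt_trans_real with S; [lra|exact HST].
Qed.

Lemma is_solution_of_volterra (x : R -> R) :
  (forall t, continuous x t) ->
  (forall t, 0 <= t -> x t = volterra kernel h psi (fun s => force psi (x s)) t) ->
  is_solution f w h psi p_infty x.
Proof.
  intros Hxc Hx.
  assert (Huc : forall s, continuous (fun s => force psi (x s)) s).
  { intros s. apply (continuous_comp x (force psi)); [apply Hxc|apply continuous_force, psi_pos]. }
  assert (Hge : forall t, 0 <= t -> psi <= x t).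
  { intros t Ht. rewrite Hx, volterra_split by (auto using continuous_kernel).
    assert (0 <= RInt (conv kernel (fun s => force psi (x s))) 0 t).
    { apply RInt_ge_0; [exact Ht| |].
      - apply ex_RInt_cont; intros; apply continuous_conv; auto using continuous_kernel.
      - intros r Hr. apply conv_nonneg; auto using continuous_kernel, kernel_nonneg; [lra|].
        intros; apply Rlt_le, force_pos, psi_pos. }
    specialize (H_pos t Ht). lra. }
  split; [|split].
  - rewrite Hx by lra. apply volterra_0.
  - intros t _ _ P HP. specialize (Hxc t P HP). unfold filtermap, within.
    apply (filter_imp (fun v => P (x v))); [auto|exact Hxc].
  - intros t Ht _.
    apply (is_derive_ext_loc (volterra kernel h psi (fun s => force psi (x s)))).
    { exists (mkposreal t Ht); intros v Hv. apply Rabs_def2 in Hv; simpl in Hv.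
      unfold minus, plus, opp in Hv; simpl in Hv. symmetry; apply Hx; lra. }
    replace (RInt (fun s => w (t - s) * f (x s)) 0 t) with (conv kernel (fun s => force psi (x s)) t).
    { apply is_derive_volterra; auto using continuous_kernel. }
    apply RInt_ext; intros s Hs. rewrite Rmin_left, Rmax_right in Hs by lra.
    unfold kernel, force. rewrite !Rmax_right by (try apply Hge; lra). reflexivity.
Qed.

Context (f_asy : asymp_increasing f) (f_super : is_lim (fun x => f x / x) p_infty p_infty)
  (f_int0 : ex_RInt_gen f (at_right 0) (at_point 1))
  (f_osgood : forall eta, 0 < eta ->
      is_lim (fun X => RInt (fun u => / sqrt (Fprim f u)) eta X) p_infty p_infty).

Lemma global_solution_exists : exists x, is_solution f w h psi p_infty x.
Proof.
  destruct (asymp_increasing_majorant f f_cont f_pos f_int0 psi psi_pos f_asy f_super f_osgood)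
    as [g [Hgc [Hg0 [Hgm [Hfg Hgo]]]]].
  destruct (volterra_exists kernel h continuous_kernel h_cont kernel_nonneg (force psi) g psi)
    as [x [Hxc Hx]]; auto.
  - intros; apply continuous_force, psi_pos.
  - intros; apply Rlt_le, force_pos, psi_pos.
  - intros x Hx. unfold force. rewrite Rmax_right by exact Hx. apply Hfg, Hx.
  - exists x. apply is_solution_of_volterra; assumption.
Qed.

(** [delayed_bound] is used with zero delay on [0, t] for each t < T; its M depends on T alone, so
    the solution cannot blow up at T. *)
Lemma solution_bounded (T : R) (x : R -> R) :
  is_solution f w h psi T x -> exists M, forall t, 0 <= t < T -> x t <= M.
Proof.
  intros Hsol.
  destruct (asymp_increasing_majorant f f_cont f_pos f_int0 psi psi_pos f_asy f_super f_osgood)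
    as [g [Hgc [Hg0 [Hgm [Hfg Hgo]]]]].
  destruct (delayed_bound kernel h continuous_kernel h_cont kernel_nonneg (force psi) g psi)
    with T as [M HM]; auto.
  - intros; apply continuous_force, psi_pos.
  - intros; apply Rlt_le, force_pos, psi_pos.
  - intros y Hy. unfold force. rewrite Rmax_right by exact Hy. apply Hfg, Hy.
  - exists M; intros t Ht. rewrite <- (restrict_eq t x t) by lra.
    apply (HM (restrict t x) 0 t); try lra.
    + intros; apply (continuous_restrict T); [exact Hsol|lra|apply Ht].
    + intros s Hs. rewrite restrict_eq by lra.
      rewrite (solution_volterra T x t Hsol ltac:(lra) (proj2 Ht)) by lra.
      apply volterra_ext; [lra|]. intros r Hr. unfold delayed.
      rewrite Rminus_0_r, Rmax_right by lra. reflexivity.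
Qed.

End Solutions.

(** * The inverse of [F_U] *)

Section Growth.
Context (f : R -> R)
  (f_cont : forall x, 0 < x -> continuous f x)
  (f_pos : forall x, 0 < x -> 0 < f x)
  (f_int0 : ex_RInt_gen f (at_right 0) (at_point 1)).

(** The energy identity as a first-order equation: the inverse E of [F_U] satisfies E' = speed E and
    (speed E)' = f(E) / 2. *)
Definition speed (u : R) : R := sqrt (Fprim f u).

Lemma speed_pos (u : R) : 0 < u -> 0 < speed u.
Proof. intros Hu. apply sqrt_lt_R0, Fprim_pos; auto. Qed.

Lemma is_derive_speed (u : R) : 0 < u -> is_derive speed u (f u / (2 * speed u)).
Proof.
  intros Hu. assert (HF := Fprim_pos f f_cont f_pos f_int0 u Hu).
  assert (H := is_derive_sqrt (Fprim f) u (f u) (is_derive_Fprim f f_cont f_int0 u Hu) HF).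
  exact H.
Qed.

Lemma is_derive_F_U (u : R) : 0 < u -> is_derive (F_U f) u (/ speed u).
Proof.
  intros Hu. apply (is_derive_RInt_pos (fun u => / sqrt (Fprim f u))); [|lra|exact Hu].
  intros; apply continuous_inv_sqrt_Fprim; auto.
Qed.

Lemma F_U_MVT (u v : R) : 0 < u -> 0 < v ->
  exists c, Rmin u v <= c <= Rmax u v /\ F_U f v - F_U f u = / speed c * (v - u).
Proof.
  intros Hu Hv. assert (Hm : 0 < Rmin u v) by (apply Rmin_glb_lt; assumption).
  apply MVT_gen.
  - intros c Hc. apply is_derive_F_U. lra.
  - intros c Hc. apply continuity_pt_filterlim. eapply is_derive_continuous, is_derive_F_U. lra.
Qed.

Lemma F_U_lt (u v : R) : 0 < u -> u < v -> F_U f u < F_U f v.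
Proof.
  intros Hu Huv. destruct (F_U_MVT u v) as [c [Hc Heq]]; [lra|lra|].
  rewrite Rmin_left, Rmax_right in Hc by lra.
  assert (0 < / speed c * (v - u)); [|lra].
  apply Rmult_lt_0_compat; [apply Rinv_0_lt_compat, speed_pos|]; lra.
Qed.

Lemma F_U_le (u v : R) : 0 < u -> u <= v -> F_U f u <= F_U f v.
Proof. intros Hu [Huv| ->]; [apply Rlt_le, F_U_lt; lra|lra]. Qed.

Lemma F_U_le_inv (u v : R) : 0 < v -> F_U f u <= F_U f v -> u <= v.
Proof.
  intros Hv H. apply Rnot_lt_le; intros Hlt. generalize (F_U_lt v u Hv Hlt). lra.
Qed.

Lemma F_U_1 : F_U f 1 = 0.
Proof. exact (RInt_point 1 _). Qed.

Context (f_osgood : is_lim (F_U f) p_infty p_infty).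

(** Divergence makes [F_U] unbounded and F_U 1 = 0, so the intermediate value theorem reaches every
    s >= 0 on [1, oo). *)
Lemma F_U_inverse_exists : exists E, forall s, 0 <= s -> 1 <= E s /\ F_U f (E s) = s.
Proof.
  apply (functional_choice (fun s y => 0 <= s -> 1 <= y /\ F_U f y = s)).
  intros s. destruct (Rle_dec 0 s) as [Hs|Hs]; [|exists 0; lra].
  destruct (is_lim_p_infty_gt _ s f_osgood) as [X HX].
  set (b := Rmax 1 (X + 1)).
  assert (Hb : 1 <= b /\ X < b) by (unfold b; generalize (Rmax_l 1 (X + 1)) (Rmax_r 1 (X + 1)); lra).
  destruct (IVT_gen (fun y => F_U f (Rmax 1 y)) 1 b s) as [y [_ Hy]].
  - intros y. apply continuity_pt_filterlim.
    apply (continuous_comp (Rmax 1) (F_U f)); [apply continuous_Rmax_l|].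
    eapply is_derive_continuous, is_derive_F_U. generalize (Rmax_l 1 y); lra.
  - rewrite !Rmax_right by lra. rewrite F_U_1. specialize (HX b (proj2 Hb)).
    rewrite Rmin_left, Rmax_right by lra. lra.
  - exists (Rmax 1 y); intros _; split; [apply Rmax_l|exact Hy].
Qed.

Context (E : R -> R) (E_spec : forall s, 0 <= s -> 1 <= E s /\ F_U f (E s) = s).

Lemma E_pos (s : R) : 0 <= s -> 0 < E s.
Proof. intros Hs. destruct (E_spec s Hs); lra. Qed.

Lemma E_mono (s t : R) : 0 <= s -> s <= t -> E s <= E t.
Proof.
  intros Hs Hst. apply F_U_le_inv; [apply E_pos; lra|].
  rewrite !(fun s Hs => proj2 (E_spec s Hs)) by lra. exact Hst.
Qed.

Lemma le_E (u s : R) : 0 <= s -> F_U f u <= s -> u <= E s.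
Proof.
  intros Hs Hus. apply F_U_le_inv; [apply E_pos, Hs|]. rewrite (proj2 (E_spec s Hs)). exact Hus.
Qed.

Lemma continuous_E (s : R) : 0 < s -> continuous E s.
Proof.
  intros Hs. destruct (E_spec s) as [HE1 HEs]; [lra|].
  apply continuous_eps; intros eps He.
  set (e := Rmin eps (1 / 2)).
  assert (Hee : 0 < e /\ e <= eps /\ e <= 1 / 2).
  { unfold e. split; [apply Rmin_glb_lt; lra|split; [apply Rmin_l|apply Rmin_r]]. }
  assert (H1 := F_U_lt (E s - e) (E s) ltac:(lra) ltac:(lra)).
  assert (H2 := F_U_lt (E s) (E s + e) ltac:(lra) ltac:(lra)).
  rewrite HEs in H1, H2.
  exists (Rmin s (Rmin (s - F_U f (E s - e)) (F_U f (E s + e) - s))); split.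
  { repeat apply Rmin_glb_lt; lra. }
  intros t Ht. apply Rabs_def2 in Ht.
  assert (Hm := Rmin_l s (Rmin (s - F_U f (E s - e)) (F_U f (E s + e) - s))).
  assert (Hm1 := Rmin_r s (Rmin (s - F_U f (E s - e)) (F_U f (E s + e) - s))).
  assert (Hm2 := Rmin_l (s - F_U f (E s - e)) (F_U f (E s + e) - s)).
  assert (Hm3 := Rmin_r (s - F_U f (E s - e)) (F_U f (E s + e) - s)).
  destruct (E_spec t) as [HEt1 HEt]; [lra|].
  assert (E t < E s + e).
  { apply Rnot_le_lt; intros Hn. apply F_U_le in Hn; lra. }
  assert (E s - e < E t).
  { apply Rnot_le_lt; intros Hn. apply F_U_le in Hn; lra. }
  apply Rabs_def1; lra.
Qed.

(** By the mean value theorem for [F_U], the difference quotient of E equals [speed c] for some c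
    between the two values of E; continuity of E and of [speed] finishes. *)
Lemma is_derive_E (s : R) : 0 < s -> is_derive E s (speed (E s)).
Proof.
  intros Hs. assert (HEs := E_pos s ltac:(lra)).
  apply is_derive_Reals. intros eps He.
  assert (Hsc : continuous speed (E s)) by (eapply is_derive_continuous, is_derive_speed, HEs).
  destruct (proj1 (continuous_eps _ _) Hsc eps He) as [d1 [Hd1 H1]].
  destruct (proj1 (continuous_eps _ _) (continuous_E s Hs) d1 Hd1) as [d2 [Hd2 H2]].
  assert (Hd : 0 < Rmin s d2) by (apply Rmin_glb_lt; lra).
  exists (mkposreal _ Hd); intros t Ht0 Ht; simpl in Ht.
  assert (Hts : Rabs t < s) by (eapply Rlt_le_trans; [exact Ht|apply Rmin_l]).
  assert (Htd : Rabs t < d2) by (eapply Rlt_le_trans; [exact Ht|apply Rmin_r]).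
  apply Rabs_def2 in Hts.
  specialize (H2 (s + t)). replace (s + t - s) with t in H2 by ring. specialize (H2 Htd).
  assert (HEt := E_pos (s + t) ltac:(lra)).
  destruct (F_U_MVT (E s) (E (s + t)) HEs HEt) as [c [Hc Heq]].
  rewrite !(fun s Hs => proj2 (E_spec s Hs)) in Heq by lra.
  assert (Hc0 : 0 < c).
  { eapply Rlt_le_trans; [|apply Hc]. apply Rmin_glb_lt; assumption. }
  assert (Hsp := speed_pos c Hc0).
  replace ((E (s + t) - E s) / t) with (speed c).
  2:{ apply Rmult_eq_reg_r with t; [|exact Ht0]. unfold Rdiv.
      rewrite Rmult_assoc, Rinv_l, Rmult_1_r by exact Ht0.
      apply Rmult_eq_reg_l with (/ speed c); [|apply Rinv_neq_0_compat; lra].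
      rewrite <- Heq. field; lra. }
  apply H1. eapply Rle_lt_trans; [|exact H2].
  revert Hc. unfold Rmin, Rmax; destruct (Rle_dec (E s) (E (s + t)));
    unfold Rabs; repeat destruct Rcase_abs; lra.
Qed.

Lemma is_derive_speed_E (s : R) : 0 < s -> is_derive (fun s => speed (E s)) s (f (E s) / 2).
Proof.
  intros Hs. assert (HEs := E_pos s ltac:(lra)). assert (Hsp := speed_pos _ HEs).
  replace (f (E s) / 2) with (speed (E s) * (f (E s) / (2 * speed (E s)))) by (field; lra).
  apply (is_derive_comp speed E); [apply is_derive_speed, HEs|apply is_derive_E, Hs].
Qed.

Context (f_mono : forall x y, 0 < x -> x < y -> f x <= f y)
  (f_super : is_lim (fun x => f x / x) p_infty p_infty).

Lemma f_le (x y : R) : 0 < x -> x <= y -> f x <= f y.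
Proof. intros Hx [Hxy| ->]; [apply f_mono; assumption|lra]. Qed.

(** F(u) is at least its part over [u / 2, u], hence at least (u / 2) f(u / 2). The factor 4 K^2 in
    f(x) >= 4 K^2 x turns this into K^2 u^2. *)
Lemma speed_superlinear (K : R) : 0 < K -> exists X, forall u, X <= u -> K * u <= speed u.
Proof.
  intros HK. destruct (is_lim_p_infty_gt _ (4 * (K * K)) f_super) as [X HX].
  exists (Rmax 2 (2 * X + 1)); intros u Hu.
  assert (Hu' : 2 <= u /\ 2 * X < u).
  { generalize (Rmax_l 2 (2 * X + 1)) (Rmax_r 2 (2 * X + 1)); lra. }
  specialize (HX (u / 2) ltac:(lra)).
  assert (Hf2 : 4 * (K * K) * (u / 2) <= f (u / 2)).
  { replace (f (u / 2)) with (f (u / 2) / (u / 2) * (u / 2)) by (field; lra).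
    apply Rmult_le_compat_r; lra. }
  rewrite <- (sqrt_square (K * u)) by (apply Rmult_le_pos; lra).
  apply sqrt_le_1_alt. rewrite (Fprim_split f f_cont f_int0 (u / 2) u) by lra.
  assert (H0 := Fprim_pos f f_cont f_pos f_int0 (u / 2) ltac:(lra)).
  assert (HI : RInt (fun _ => f (u / 2)) (u / 2) u <= RInt f (u / 2) u).
  { apply RInt_le; [lra|apply ex_RInt_const|apply ex_RInt_pos; auto; lra|].
    intros x Hx. apply f_le; lra. }
  rewrite RInt_const in HI. unfold scal in HI; simpl in HI; unfold mult in HI; simpl in HI.
  assert (u / 2 * (4 * (K * K) * (u / 2)) <= u / 2 * f (u / 2)) by (apply Rmult_le_compat_l; lra).
  lra.
Qed.

(** On [s, s + d] the derivative [speed (E t)] is at least (K / d) E(t) >= (K / d) E(s), so E gains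
    at least K E(s). *)
Lemma E_supexp (K d : R) : 0 < K -> 0 < d -> exists S, 0 < S /\ forall s, S <= s -> K * E s <= E (s + d).
Proof.
  intros HK Hd. destruct (speed_superlinear (K / d)) as [X HX]; [apply Rdiv_lt_0_compat; lra|].
  set (S := Rmax 1 (F_U f X)). exists S.
  assert (HS : 1 <= S /\ F_U f X <= S) by (split; [apply Rmax_l|apply Rmax_r]).
  split; [lra|]. intros s Hs. assert (HEs := E_pos s ltac:(lra)).
  assert (HD : forall t, is_derive (fun t => K / d * E s * t) t (K / d * E s))
    by (intros; apply is_derive_linear).
  assert (H : K / d * E s * (s + d) - K / d * E s * s <= E (s + d) - E s).
  { apply (derive_le _ _ _ _ s (s + d) ltac:(lra) (fun t _ => HD t)
      (fun t Ht => is_derive_E t ltac:(lra))).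
    - intros t _; eapply is_derive_continuous, HD.
    - intros t Ht; apply continuous_E; lra.
    - intros t Ht. apply Rle_trans with (K / d * E t).
      + apply Rmult_le_compat_l; [apply Rlt_le, Rdiv_lt_0_compat; lra|apply E_mono; lra].
      + apply HX, le_E; lra. }
  replace (K / d * E s * (s + d) - K / d * E s * s) with (K * E s) in H by (field; lra). lra.
Qed.

(** Monotonicity of F(u) / u in product form: F(u) <= u f(u) bounds F(u) (v - u) by u times the
    integral of f over [u, v]. It transfers the growth of E to [speed E], with K^2 in place of K
    because of the square root. *)
Lemma Fprim_ratio (u v : R) : 0 < u -> u <= v -> Fprim f u * v <= u * Fprim f v.
Proof.
  intros Hu Huv. rewrite (Fprim_split f f_cont f_int0 u v) by lra.
  assert (H := Fprim_le_mult f f_cont f_pos f_int0 u f_mono Hu).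
  assert (HI : RInt (fun _ => f u) u v <= RInt f u v).
  { apply RInt_le; [lra|apply ex_RInt_const|apply ex_RInt_pos; auto; lra|].
    intros x Hx. apply f_le; lra. }
  rewrite RInt_const in HI. unfold scal in HI; simpl in HI; unfold mult in HI; simpl in HI.
  assert (Fprim f u * (v - u) <= u * f u * (v - u)) by (apply Rmult_le_compat_r; lra).
  assert (u * ((v - u) * f u) <= u * RInt f u v) by (apply Rmult_le_compat_l; lra).
  lra.
Qed.

Lemma speed_E_supexp (K d : R) : 0 < K -> 0 < d ->
  exists S, 0 < S /\ forall s, S <= s -> K * speed (E s) <= speed (E (s + d)).
Proof.
  intros HK Hd. destruct (E_supexp (K * K) d) as [S [HS H]]; [nra|exact Hd|].
  exists S; split; [exact HS|]. intros s Hs. specialize (H s Hs).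
  assert (HEs := E_pos s ltac:(lra)). assert (HEsd := E_mono s (s + d) ltac:(lra) ltac:(lra)).
  unfold speed. rewrite <- (sqrt_square K) at 1 by lra.
  rewrite <- sqrt_mult; [|nra|apply Rlt_le, Fprim_pos; auto].
  apply sqrt_le_1_alt.
  apply Rmult_le_reg_l with (E s); [exact HEs|].
  eapply Rle_trans; [|apply Fprim_ratio; assumption].
  assert (0 < Fprim f (E s)) by (apply Fprim_pos; auto). nra.
Qed.

Context (f_ratio : eventually_increasing (fun x => f x / x)).

(** The window is halved. Over the first half E grows by the factor 4 K / d, and monotonicity of
    f(x) / x passes this factor to f. Over the second half [speed E] has derivative f(E) / 2, so it
    gains at least (d / 4) f(E (s + d / 2)) >= K f(E s). *)
Lemma f_E_supexp (K d : R) : 0 < K -> 0 < d ->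
  exists S, 0 < S /\ forall s, S <= s -> K * f (E s) <= speed (E (s + d)).
Proof.
  intros HK Hd. destruct f_ratio as [X HX].
  destruct (E_supexp (4 * K / d) (d / 2)) as [S [HS H]]; [apply Rdiv_lt_0_compat; lra|lra|].
  set (S' := Rmax S (F_U f X)). exists S'.
  assert (HS' : S <= S' /\ F_U f X <= S') by (split; [apply Rmax_l|apply Rmax_r]).
  split; [lra|]. intros s Hs. specialize (H s ltac:(lra)).
  assert (HEs := E_pos s ltac:(lra)). assert (HEsd := E_mono s (s + d / 2) ltac:(lra) ltac:(lra)).
  set (v := E (s + d / 2)) in *.
  assert (Hv : 4 * K / d * f (E s) <= f v).
  { assert (Hr : f (E s) / E s <= f v / v).
    { destruct HEsd as [Hlt|Heq]; [|rewrite Heq; lra]. apply HX; [apply le_E; lra|exact Hlt]. }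
    assert (0 < f (E s) / E s) by (apply Rdiv_lt_0_compat; [apply f_pos|]; lra).
    replace (f v) with (f v / v * v) by (field; lra).
    replace (4 * K / d * f (E s)) with (f (E s) / E s * (4 * K / d * E s)) by (field; lra).
    apply Rmult_le_compat; try lra.
    apply Rmult_le_pos; [apply Rlt_le, Rdiv_lt_0_compat|]; lra. }
  assert (HD : forall t, is_derive (fun t => f v / 2 * t) t (f v / 2))
    by (intros; apply is_derive_linear).
  assert (Hinc : f v / 2 * (s + d) - f v / 2 * (s + d / 2)
    <= speed (E (s + d)) - speed (E (s + d / 2))).
  { apply (derive_le _ _ _ _ (s + d / 2) (s + d) ltac:(lra) (fun t _ => HD t)
      (fun t Ht => is_derive_speed_E t ltac:(lra))).
    - intros t _; eapply is_derive_continuous, HD.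
    - intros t Ht; eapply is_derive_continuous, is_derive_speed_E; lra.
    - intros t Ht. assert (f v <= f (E t)); [|lra].
      apply f_le; [lra|]. apply E_mono; lra. }
  fold v in Hinc. assert (0 < speed v) by (apply speed_pos; lra).
  assert (HKd : d / 4 * (4 * K / d * f (E s)) <= d / 4 * f v) by (apply Rmult_le_compat_l; lra).
  replace (d / 4 * (4 * K / d * f (E s))) with (K * f (E s)) in HKd by (field; lra).
  lra.
Qed.

End Growth.

(** * Lower and upper growth bounds *)

Section ConvolutionBounds.
Context (k : R -> R) (k_cont : forall x, continuous k x) (k_pos : forall x, 0 <= k x).

Lemma conv_split (u : R -> R) (q r : R) : (forall x, continuous u x) ->
  conv k u r = RInt (fun s => k (r - s) * u s) 0 q + RInt (fun s => k (r - s) * u s) q r.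
Proof. intros Hu. apply RInt_split; apply ex_RInt_conv; auto. Qed.

Lemma conv_ge_recent (u : R -> R) (a d r : R) :
  (forall x, continuous u x) -> (forall x, 0 <= u x) -> 0 <= d <= r ->
  (forall s, 0 <= s <= d -> a <= k s) -> a * RInt u (r - d) r <= conv k u r.
Proof.
  intros Hu Hu0 Hd Ha. rewrite (conv_split u (r - d) r Hu).
  assert (0 <= RInt (fun s => k (r - s) * u s) 0 (r - d)).
  { apply RInt_ge_0; [lra|apply ex_RInt_conv; auto|]. intros; apply Rmult_le_pos; auto. }
  rewrite <- RInt_Rscal by (apply ex_RInt_cont, Hu).
  assert (RInt (fun s => a * u s) (r - d) r <= RInt (fun s => k (r - s) * u s) (r - d) r); [|lra].
  apply RInt_le; [lra| |apply ex_RInt_conv; auto|].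
  - apply (ex_RInt_scal u), ex_RInt_cont, Hu.
  - intros s Hs. apply Rmult_le_compat_r; [auto|]. apply Ha; lra.
Qed.

Lemma recent_le (u : R -> R) (a q r : R) :
  (forall x, continuous u x) -> (forall x, 0 <= u x) -> q <= r ->
  (forall s, 0 <= s <= r - q -> k s <= a) ->
  RInt (fun s => k (r - s) * u s) q r <= a * RInt u q r.
Proof.
  intros Hu Hu0 Hq Ha. rewrite <- RInt_Rscal by (apply ex_RInt_cont, Hu).
  apply RInt_le; [lra|apply ex_RInt_conv; auto| |].
  - apply (ex_RInt_scal u), ex_RInt_cont, Hu.
  - intros s Hs. apply Rmult_le_compat_r; [auto|]. apply Ha; lra.
Qed.

(** Reflection s -> r - s turns the kernel factor into the integral of k over [r - q, r], at most
    that over [0, r]. Integrability of w makes the bound uniform in r. *)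
Lemma remote_le (u : R -> R) (m B q r : R) :
  (forall x, continuous u x) -> 0 <= q <= r -> 0 <= m ->
  (forall s, 0 <= s <= q -> u s <= m) -> (forall t, 0 <= t -> RInt k 0 t <= B) ->
  RInt (fun s => k (r - s) * u s) 0 q <= m * B.
Proof.
  intros Hu Hq Hm Hum HB.
  assert (Hc : forall s, continuous (fun s => k (r - s)) s).
  { intros s. apply (continuous_comp (fun s => r - s) k); [|apply k_cont].
    apply continuous_Rminus; [apply continuous_const|apply continuous_id]. }
  apply Rle_trans with (m * RInt (fun s => k (r - s)) 0 q).
  - rewrite <- RInt_Rscal by (apply ex_RInt_cont, Hc).
    apply RInt_le; [lra|apply ex_RInt_conv; auto| |].
    + apply (ex_RInt_scal (fun s => k (r - s))), ex_RInt_cont, Hc.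
    + intros s Hs. rewrite (Rmult_comm m). apply Rmult_le_compat_l; [auto|apply Hum; lra].
  - apply Rmult_le_compat_l; [exact Hm|].
    assert (Hlin := RInt_comp_lin k (-1) r 0 q).
    replace (-1 * 0 + r) with r in Hlin by ring. replace (-1 * q + r) with (r - q) in Hlin by ring.
    specialize (Hlin (ex_RInt_cont k _ _ k_cont)).
    rewrite (RInt_ext _ (fun s => -1 * k (r - s))) in Hlin.
    2:{ intros s _. replace (-1 * s + r) with (r - s) by ring. reflexivity. }
    rewrite (RInt_Rscal (fun s => k (r - s))) in Hlin by (apply ex_RInt_cont, Hc).
    assert (Hs := RInt_split k 0 (r - q) r (ex_RInt_cont _ _ _ k_cont) (ex_RInt_cont _ _ _ k_cont)).
    assert (Hs' := RInt_split k r (r - q) r (ex_RInt_cont _ _ _ k_cont) (ex_RInt_cont _ _ _ k_cont)).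
    assert (Hz : RInt k r r = 0) by exact (RInt_point r k). rewrite Hz in Hs'.
    assert (0 <= RInt k 0 (r - q)) by (apply RInt_ge_0; [lra|apply ex_RInt_cont, k_cont|auto]).
    specialize (HB r ltac:(lra)).
    change (RInt (fun s => k (r - s)) 0 q <= B).
    change (-1 * RInt (fun s => k (r - s)) 0 q = RInt k r (r - q)) in Hlin.
    lra.
Qed.

End ConvolutionBounds.

(** * Comparison of solutions with time shifts of E *)

Section Asymptotics.
Context (f : R -> R)
  (f_cont : forall x, 0 < x -> continuous f x)
  (f_pos : forall x, 0 < x -> 0 < f x)
  (f_int0 : ex_RInt_gen f (at_right 0) (at_point 1))
  (f_mono : forall x y, 0 < x -> x < y -> f x <= f y)
  (f_super : is_lim (fun x => f x / x) p_infty p_infty)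
  (E : R -> R) (E_spec : forall s, 0 <= s -> 1 <= E s /\ F_U f (E s) = s)
  (k h : R -> R) (k_cont : forall x, continuous k x) (k_pos : forall x, 0 <= k x)
  (k_0 : 0 < k 0) (h_cont : forall x, continuous h x)
  (H_pos : forall t, 0 <= t -> 0 <= Hint h t)
  (psi : R) (psi_pos : 0 < psi)
  (x : R -> R) (x_cont : forall t, continuous x t) (x_ge : forall t, psi <= x t)
  (x_eq : forall t, 0 <= t -> x t = volterra k h psi (fun s => f (x s)) t).

Lemma continuous_force_x (t : R) : continuous (fun s => f (x s)) t.
Proof.
  apply (continuous_comp x f); [apply x_cont|]. apply f_cont. specialize (x_ge t); lra.
Qed.

Lemma force_x_pos (t : R) : 0 < f (x t).
Proof. apply f_pos. specialize (x_ge t); lra. Qed.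

(* [y = E (c t)] solves [y'' = (c^2 / 2) f(y)]; when [c^2 / 2 < k 0] it is eventually a
   subsolution of the equation truncated to the memory window [t - d, t]. *)
Lemma F_U_solution_lower (c : R) : 0 < c -> c < sqrt (2 * k 0) ->
  exists A B, forall t, A <= t -> c * t - B <= F_U f (x t).
Proof.
  intros Hc Hck.
  set (b := c * c / 2).
  assert (Hb : 0 < b < k 0).
  { unfold b. assert (Hs := sqrt_sqrt (2 * k 0) ltac:(lra)).
    assert (c * c < sqrt (2 * k 0) * sqrt (2 * k 0)) by (apply Rmult_le_0_lt_compat; lra). nra. }
  set (a := (b + k 0) / 2).
  destruct (proj1 (continuous_eps k 0) (k_cont 0) (k 0 - a)) as [d' [Hd' Hkd]]; [unfold a; lra|].
  set (d := d' / 2).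
  assert (Hd : 0 < d) by (unfold d; lra).
  assert (Hka : forall s, 0 <= s <= d -> a <= k s).
  { intros s Hs. specialize (Hkd s). rewrite Rminus_0_r, Rabs_pos_eq in Hkd by lra.
    specialize (Hkd ltac:(unfold d in Hs; lra)). apply Rabs_def2 in Hkd. lra. }
  assert (Hab : b < a < k 0) by (unfold a; lra).
  set (u := fun s => f (x s)).
  assert (Huc : forall s, continuous u s) by apply continuous_force_x.
  assert (Hu0 : forall s, 0 <= u s) by (intros; apply Rlt_le, force_x_pos).
  assert (Hcc : forall t, continuous (conv k u) t) by (intros; apply continuous_conv; auto).
  (* The solution without [Hint h], of which only the sign is used: z <= x, and z' = conv k u is
     free of h. *)
  set (z := fun t => psi + RInt (conv k u) 0 t).
  assert (Hzd : forall t, is_derive z t (conv k u t)).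
  { intros t. replace (conv k u t) with (0 + conv k u t) by ring.
    apply (is_derive_plus (V := R_NormedModule)); [apply (is_derive_const (V := R_NormedModule))|].
    apply is_derive_RInt_cont, Hcc. }
  assert (Hzc : forall t, continuous z t) by (intros; eapply is_derive_continuous, Hzd).
  assert (Hconv0 : forall t, 0 <= t -> 0 <= conv k u t) by (intros; apply conv_nonneg; auto).
  assert (Hzpsi : forall t, 0 <= t -> psi <= z t).
  { intros t Ht. unfold z. assert (0 <= RInt (conv k u) 0 t); [|lra].
    apply RInt_ge_0; [exact Ht|apply ex_RInt_cont, Hcc|]. intros; apply Hconv0; lra. }
  assert (Hzx : forall t, 0 <= t -> z t <= x t).
  { intros t Ht. rewrite x_eq, volterra_split by auto. specialize (H_pos t Ht).
    unfold z. change (fun s => f (x s)) with u. lra. }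
  (* The comparison has to start with z above Y. Since f(x) >= f psi, z grows at least linearly and
     overtakes any prescribed value of Y. *)
  assert (Hzlin : forall t, d <= t -> psi + a * (d * f psi) * (t - d) <= z t).
  { intros t Ht.
    assert (HD : forall s, is_derive (fun s => a * (d * f psi) * s) s (a * (d * f psi)))
      by (intros; apply is_derive_linear).
    assert (H := derive_le _ _ _ _ d t Ht (fun s _ => HD s) (fun s _ => Hzd s)
      (fun s _ => is_derive_continuous _ _ _ (HD s)) (fun s _ => Hzc s)).
    assert (Hz := Hzpsi d ltac:(lra)).
    cut (a * (d * f psi) * t - a * (d * f psi) * d <= z t - z d); [lra|].
    apply H. intros s Hs.
    eapply Rle_trans; [|apply (conv_ge_recent k k_cont k_pos u a d s); auto; lra].
    apply Rmult_le_compat_l; [lra|].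
    replace (d * f psi) with (RInt (fun _ => f psi) (s - d) s).
    2:{ rewrite RInt_const. unfold scal; simpl; unfold mult; simpl; ring. }
    apply RInt_le; [lra|apply ex_RInt_const|apply ex_RInt_cont, Huc|].
    intros v _. apply (f_le f f_mono); auto. }
  (* Growth by the factor K over the window means v (t - d) <= (1 - b / a) v t, that is v t <= (a /
     b) (v t - v (t - d)). *)
  set (K := / (1 - b / a)).
  assert (Hba : 0 < b / a < 1).
  { split; [apply Rdiv_lt_0_compat; lra|]. apply Rmult_lt_reg_r with a; [lra|].
    unfold Rdiv; rewrite Rmult_assoc, Rinv_l by lra. lra. }
  destruct (speed_E_supexp f f_cont f_pos f_int0 E E_spec f_mono f_super K (c * d))
    as [S [HS HSs]]; [apply Rinv_0_lt_compat; lra|nra|].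
  set (Y := fun t => E (c * t)).
  set (v := fun t => c * speed f (E (c * t))).
  assert (HYd : forall t, 0 < t -> is_derive Y t (v t)).
  { intros t Ht. assert (Hct : 0 < c * t) by nra. apply (is_derive_comp E (fun t => c * t)).
    - apply (is_derive_E f f_cont f_pos f_int0 E E_spec), Hct.
    - apply is_derive_linear. }
  assert (HYc : forall t, 0 < t -> continuous Y t) by (intros; eapply is_derive_continuous, HYd; auto).
  assert (HYpos : forall t, 0 <= t -> 0 < Y t).
  { intros t Ht. apply (E_pos f E E_spec). nra. }
  assert (HYmono : forall s t, 0 <= s -> s <= t -> Y s <= Y t).
  { intros s t Hs Hst. apply (E_mono f f_cont f_pos f_int0 E E_spec); [nra|].
    apply Rmult_le_compat_l; lra. }
  assert (Hvd : forall t, 0 < t -> is_derive v t (b * f (Y t))).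
  { intros t Ht. assert (Hct : 0 < c * t) by nra.
    replace (b * f (Y t)) with (c * (c * (f (Y t) / 2))) by (unfold b; field).
    apply is_derive_scal, (is_derive_comp (fun s => speed f (E s)) (fun t => c * t)).
    - apply (is_derive_speed_E f f_cont f_pos f_int0 E E_spec), Hct.
    - apply is_derive_linear. }
  set (t1 := S / c + d).
  assert (HSc : 0 < S / c) by (apply Rdiv_lt_0_compat; lra).
  assert (Ht1 : forall t, t1 <= t -> v t <= a / b * (v t - v (t - d))).
  { intros t Ht. assert (HSt : S <= c * (t - d)).
    { replace S with (c * (S / c)) by (field; lra). apply Rmult_le_compat_l; unfold t1 in Ht; lra. }
    specialize (HSs _ HSt). replace (c * (t - d) + c * d) with (c * t) in HSs by ring.
    assert (Hkv : v (t - d) <= (1 - b / a) * v t).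
    { unfold v. apply Rmult_le_reg_l with K; [apply Rinv_0_lt_compat; lra|].
      replace (K * ((1 - b / a) * (c * speed f (E (c * t))))) with (c * speed f (E (c * t))).
      - replace (K * (c * speed f (E (c * (t - d))))) with (c * (K * speed f (E (c * (t - d))))) by ring.
        apply Rmult_le_compat_l; lra.
      - unfold K. rewrite <- Rmult_assoc, Rinv_l by lra. ring. }
    replace (v t) with (a / b * (b / a * v t)) at 1 by (field; lra).
    apply Rmult_le_compat_l; [apply Rlt_le, Rdiv_lt_0_compat; lra|]. lra. }
  set (m := a * (d * f psi)).
  assert (Hm : 0 < m) by (repeat apply Rmult_lt_0_compat; auto; lra).
  set (t0 := Rmax d (d + (Y (t1 + d) + 1) / m)).
  assert (Ht0 : d <= t0 /\ d + (Y (t1 + d) + 1) / m <= t0) by (split; [apply Rmax_l|apply Rmax_r]).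
  assert (Hzt0 : forall t, t0 <= t -> Y (t1 + d) < z t).
  { intros t Ht. eapply Rlt_le_trans; [|apply Hzlin; lra]. fold m.
    assert (Y (t1 + d) + 1 <= m * (t - d)); [|lra].
    replace (Y (t1 + d) + 1) with (m * ((Y (t1 + d) + 1) / m)) by (field; lra).
    apply Rmult_le_compat_l; lra. }
  (* Time t0 of z is matched with time t1 of Y. On the starting window [t0, t0 + d] the shifted Y is
     at most Y (t1 + d), which z already exceeds. *)
  set (sg := t1 - t0).
  assert (Ht1d : d < t1) by (unfold t1; lra).
  assert (HshY : forall t, t0 <= t -> is_derive (fun t => Y (t + sg)) t (v (t + sg))).
  { intros t Ht. replace (v (t + sg)) with (1 * v (t + sg)) by ring.
    apply (is_derive_comp Y (fun t => t + sg)); [apply HYd; unfold sg; lra|apply is_derive_shift]. }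
  assert (Hmain : forall t, t0 + d <= t -> 0 < z t - Y (t + sg)).
  { assert (Hinit : forall s, t0 <= s <= t0 + d -> Y (s + sg) < z s).
    { intros s Hs. eapply Rle_lt_trans; [|apply Hzt0; lra]. apply HYmono; unfold sg; lra. }
    apply continuous_positivity.
    - intros t Ht. apply continuous_Rminus; [apply Hzc|].
      eapply is_derive_continuous, HshY; lra.
    - specialize (Hinit (t0 + d) ltac:(lra)). lra.
    - intros t Ht Hbelow.
      assert (H : z (t0 + d) - Y (t0 + d + sg) <= z t - Y (t + sg));
        [|specialize (Hinit (t0 + d) ltac:(lra)); lra].
      assert (HDd : forall r, t0 + d <= r ->
        is_derive (fun r => z r - Y (r + sg)) r (conv k u r - v (r + sg))).
      { intros r Hr. apply (is_derive_minus (V := R_NormedModule)); [apply Hzd|apply HshY; lra]. }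
      apply (nondecreasing_of_derive (fun r => z r - Y (r + sg)) _ (t0 + d) t ltac:(lra)
        (fun r Hr => HDd r ltac:(lra))).
      { intros r Hr. eapply is_derive_continuous, HDd; lra. }
      intros r Hr.
      (* With I the integral of u over [r - d, r]: z' r >= a I >= (a / b) (v (r + sg) - v (r + sg -
         d)) >= v (r + sg). The middle step uses u s >= f (Y (s + sg)), from [Hbelow] or, where
         [r - d, r] reaches back into the starting window, from [Hinit]. *)
      assert (Hlow := conv_ge_recent k k_cont k_pos u a d r Huc Hu0 ltac:(lra) Hka).
      assert (Hy := Ht1 (r + sg) ltac:(unfold sg; lra)).
      assert (Hvint : v (r + sg) - v (r + sg - d) <= b * RInt u (r - d) r); [|
        assert (a / b * (v (r + sg) - v (r + sg - d)) <= a / b * (b * RInt u (r - d) r))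
          by (apply Rmult_le_compat_l; [apply Rlt_le, Rdiv_lt_0_compat; lra|exact Hvint]);
        replace (a / b * (b * RInt u (r - d) r)) with (a * RInt u (r - d) r) in * by (simpl; field; lra);
        lra].
      assert (HDv : forall s, r - d <= s -> is_derive (fun s => v (s + sg)) s (b * f (Y (s + sg)))).
      { intros s Hs. replace (b * f (Y (s + sg))) with (1 * (b * f (Y (s + sg)))) by ring.
        apply (is_derive_comp v (fun t => t + sg)); [apply Hvd; unfold sg; lra|apply is_derive_shift]. }
      assert (HDu : forall s, is_derive (fun s => b * RInt u (r - d) s) s (b * u s)).
      { intros s. apply is_derive_scal, is_derive_RInt_cont, Huc. }
      assert (Hle := derive_le _ _ _ _ (r - d) r ltac:(lra)
        (fun s Hs => HDv s ltac:(lra)) (fun s _ => HDu s)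
        (fun s Hs => is_derive_continuous _ _ _ (HDv s ltac:(lra)))
        (fun s _ => is_derive_continuous _ _ _ (HDu s))).
      replace (r + sg - d) with (r - d + sg) by ring.
      assert (Hpt : RInt u (r - d) (r - d) = 0) by exact (RInt_point (r - d) u).
      cut (v (r + sg) - v (r - d + sg) <= b * RInt u (r - d) r - b * RInt u (r - d) (r - d));
        [rewrite Hpt; lra|].
      apply Hle. intros s Hs. apply Rmult_le_compat_l; [lra|].
      apply (f_le f f_mono); [apply HYpos; unfold sg; lra|].
      apply Rle_trans with (z s); [|apply Hzx; lra].
      destruct (Rle_dec s (t0 + d)) as [Hsd|Hsd].
      + apply Rlt_le, Hinit; lra.
      + specialize (Hbelow s ltac:(lra)). lra. }
  exists (t0 + d), (c * t0); intros t Ht.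
  specialize (Hmain t Ht). assert (Hx := Hzx t ltac:(lra)).
  assert (HYt : F_U f (Y (t + sg)) <= F_U f (x t)).
  { apply (F_U_le f f_cont f_pos f_int0); [apply HYpos; unfold sg; lra|lra]. }
  unfold Y in HYt. rewrite (proj2 (E_spec (c * (t + sg)) ltac:(unfold sg; nra))) in HYt.
  assert (0 <= c * t1) by nra. unfold sg in HYt. lra.
Qed.

Context (f_ratio : eventually_increasing (fun x => f x / x))
  (B : R) (k_int : forall t, 0 <= t -> RInt k 0 t <= B).

(* [Y = E (c t + tau)] solves [Y'' = (c^2 / 2) f(Y)] with [c^2 / 2 > k 0]; for large [tau] it
   is a strict supersolution with slack [(1 - theta) Y], since contributions older than [d]
   are negligible against [Y']. *)
Lemma conv_E_le (c : R) : sqrt (2 * k 0) < c ->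
  exists theta S, 0 < theta < 1 /\ 0 < S /\ forall tau, S <= tau -> forall r, 0 <= r ->
    conv k (fun s => f (E (c * Rmax 0 s + tau))) r <= theta * (c * speed f (E (c * r + tau))).
Proof.
  intros Hck. assert (Hc0 : 0 < c).
  { eapply Rle_lt_trans; [apply sqrt_pos|exact Hck]. }
  set (b := c * c / 2).
  assert (Hb : k 0 < b).
  { unfold b. assert (Hs := sqrt_sqrt (2 * k 0) ltac:(lra)).
    assert (sqrt (2 * k 0) * sqrt (2 * k 0) < c * c).
    { apply Rmult_le_0_lt_compat; try apply sqrt_pos; assumption. }
    lra. }
  set (a := (b + k 0) / 2).
  assert (Hab : k 0 < a < b) by (unfold a; lra).
  destruct (proj1 (continuous_eps k 0) (k_cont 0) (a - k 0)) as [d' [Hd' Hkd]]; [lra|].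
  set (d := d' / 2).
  assert (Hd : 0 < d) by (unfold d; lra).
  assert (Hka : forall s, 0 <= s <= d -> k s <= a).
  { intros s Hs. specialize (Hkd s). rewrite Rminus_0_r, Rabs_pos_eq in Hkd by lra.
    specialize (Hkd ltac:(unfold d in Hs; lra)). apply Rabs_def2 in Hkd. lra. }
  assert (HB : 0 <= B).
  { eapply Rle_trans; [|apply (k_int 0); lra]. right; symmetry; exact (RInt_point 0 k). }
  assert (Hba : 0 < a / b < 1).
  { split; [apply Rdiv_lt_0_compat; lra|]. apply Rmult_lt_reg_r with b; [lra|].
    unfold Rdiv; rewrite Rmult_assoc, Rinv_l by lra. lra. }
  (* Half of the gap 1 - a / b is spent on the memory older than d, so theta = a / b + (1 - a / b) /
     2; the factor c turns [speed] into the derivative of Y. Below, B + 1 keeps the growth factor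
     positive when B = 0. *)
  set (kappa := (1 - a / b) / 2 * c).
  assert (Hkappa : 0 < kappa) by (unfold kappa; nra).
  destruct (f_E_supexp f f_cont f_pos f_int0 E E_spec f_mono f_super f_ratio
    ((B + 1) / kappa) (c * d)) as [S [HS HSs]].
  { apply Rdiv_lt_0_compat; lra. } { nra. }
  exists ((1 + a / b) / 2), S; split; [lra|split; [exact HS|]].
  intros tau Htau r Hr.
  set (v := fun t => c * speed f (E (c * t + tau))).
  set (u := fun s => f (E (c * Rmax 0 s + tau))).
  assert (Harg : forall s, 0 < c * Rmax 0 s + tau).
  { intros s. assert (0 <= c * Rmax 0 s) by (apply Rmult_le_pos; [lra|apply Rmax_l]). lra. }
  assert (HEpos := E_pos f E E_spec).
  assert (HEmono := E_mono f f_cont f_pos f_int0 E E_spec).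
  assert (Huc : forall s, continuous u s).
  { intros s. apply (continuous_comp (fun s => E (c * Rmax 0 s + tau)) f).
    - apply (continuous_comp (fun s => c * Rmax 0 s + tau) E).
      + apply continuous_Rplus; [|apply continuous_const].
        apply continuous_Rmult; [apply continuous_const|apply continuous_Rmax_l].
      + apply (continuous_E f f_cont f_pos f_int0 E E_spec), Harg.
    - apply f_cont, HEpos. specialize (Harg s); lra. }
  assert (Hu0 : forall s, 0 <= u s).
  { intros s. apply Rlt_le, f_pos, HEpos. specialize (Harg s); lra. }
  assert (Hv0 : forall t, 0 <= t -> 0 < v t).
  { intros t Ht. apply Rmult_lt_0_compat; [exact Hc0|]. apply speed_pos; auto. apply HEpos. nra. }
  (* v' = b u on [0, r], so the left side is bounded by v r - v q, and v q > 0 is dropped. *)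
  assert (Hvint : forall q, 0 <= q <= r -> b * RInt u q r <= v r).
  { intros q Hq.
    assert (HDv : forall s, 0 <= s -> is_derive v s (b * f (E (c * s + tau)))).
    { intros s Hs. assert (Hcs : 0 < c * s + tau) by nra.
      replace (b * f (E (c * s + tau))) with (c * (c * (f (E (c * s + tau)) / 2)))
        by (unfold b; field).
      apply is_derive_scal, (is_derive_comp (fun s => speed f (E s)) (fun t => c * t + tau));
        [|apply is_derive_affine].
      apply (is_derive_speed_E f f_cont f_pos f_int0 E E_spec), Hcs. }
    assert (HDu : forall s, is_derive (fun s => b * RInt u q s) s (b * u s)).
    { intros s. apply is_derive_scal, is_derive_RInt_cont, Huc. }
    assert (Hle := derive_le _ _ _ _ q r ltac:(lra)
      (fun s _ => HDu s) (fun s Hs => HDv s ltac:(lra))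
      (fun s _ => is_derive_continuous _ _ _ (HDu s))
      (fun s Hs => is_derive_continuous _ _ _ (HDv s ltac:(lra)))).
    assert (Hpt : RInt u q q = 0) by exact (RInt_point q u).
    assert (Hvq := Hv0 q ltac:(lra)).
    cut (b * RInt u q r - b * RInt u q q <= v r - v q); [rewrite Hpt; lra|].
    apply Hle. intros s Hs. unfold u. rewrite Rmax_right by lra. lra. }
  change (conv k u r <= (1 + a / b) / 2 * v r).
  assert (Hvr := Hv0 r Hr).
  assert (Hrec : forall q, 0 <= q <= r -> r - q <= d ->
    RInt (fun s => k (r - s) * u s) q r <= a / b * v r).
  { intros q Hq Hqd. eapply Rle_trans; [apply (recent_le k k_cont u a); auto; [lra|]|].
    { intros s Hs; apply Hka; lra. }
    replace (a * RInt u q r) with (a / b * (b * RInt u q r)) by (simpl; field; lra).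
    apply Rmult_le_compat_l; [lra|]. apply Hvint, Hq. }
  destruct (Rle_dec r d) as [Hrd|Hrd].
  - eapply Rle_trans; [apply (Hrec 0); lra|]. apply Rmult_le_compat_r; lra.
  - rewrite (conv_split k k_cont u (r - d) r Huc).
    assert (H1 := Hrec (r - d) ltac:(lra) ltac:(lra)).
    set (e := f (E (c * (r - d) + tau))).
    assert (He : 0 < e) by (apply f_pos, HEpos; nra).
    assert (H2 : RInt (fun s => k (r - s) * u s) 0 (r - d) <= e * B).
    { apply (remote_le k k_cont k_pos); auto; [lra|lra|].
      intros s Hs. unfold u, e. rewrite Rmax_right by lra.
      apply (f_le f f_mono); [apply HEpos; nra|]. apply HEmono; nra. }
    assert (H3 := HSs (c * (r - d) + tau) ltac:(nra)). fold e in H3.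
    replace (c * (r - d) + tau + c * d) with (c * r + tau) in H3 by ring.
    assert (H4 : e * B <= (1 - a / b) / 2 * v r).
    { apply Rle_trans with (kappa * ((B + 1) / kappa * e)).
      - replace (kappa * ((B + 1) / kappa * e)) with (e * (B + 1)) by (field; lra).
        apply Rmult_le_compat_l; lra.
      - apply Rle_trans with (kappa * speed f (E (c * r + tau))).
        + apply Rmult_le_compat_l; lra.
        + right. unfold kappa, v. ring. }
    lra.
Qed.

(** Integrating [conv_E_le] bounds the memory of Y by theta Y; the remaining (1 - theta) Y dominates
    psi + H once tau is large. Where H <= 0 nothing has to be compared, and [F_U] is applied to
    positive arguments only. *)
Lemma F_U_solution_upper (c c' T : R) : sqrt (2 * k 0) < c -> 0 <= c' <= c ->
  (forall t, T <= t -> 0 <= t -> 0 < Hint h t -> F_U f (Hint h t) <= c' * t) ->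
  exists tau, forall t, 0 <= t -> F_U f (x t) <= c * t + tau.
Proof.
  intros Hck Hc' HT.
  assert (Hc0 : 0 < c) by (eapply Rle_lt_trans; [apply sqrt_pos|exact Hck]).
  destruct (conv_E_le c Hck) as [theta [S1 [Hth [HS1 Hconv]]]].
  (* With e = E (c t + tau - 1), both psi <= e and H <= e, so psi + H <= 2 e < 3 e <= (1 - theta) Y
     t. One unit of the argument of E is given up to gain the factor 3 / (1 - theta). *)
  destruct (E_supexp f f_cont f_pos f_int0 E E_spec f_mono f_super (3 / (1 - theta)) 1)
    as [S2 [HS2 Hsup]]; [apply Rdiv_lt_0_compat; lra|lra|].
  destruct (continuous_bounded (Hint h) 0 T) as [M [HM HMb]].
  { intros t _. eapply is_derive_continuous, is_derive_RInt_cont, h_cont. }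
  (* S1 enables the convolution bound; the other entries, raised by 1 to match tau - 1, serve the
     growth of E, the initial value, and the values of H before T. *)
  set (tau := Rmax S1 (Rmax (S2 + 1) (Rmax (F_U f psi + 1) (F_U f M + 1)))).
  assert (Htau : S1 <= tau /\ S2 + 1 <= tau /\ F_U f psi + 1 <= tau /\ F_U f M + 1 <= tau).
  { unfold tau. split; [apply Rmax_l|].
    split; [eapply Rle_trans; [|apply Rmax_r]; apply Rmax_l|].
    split; (eapply Rle_trans; [|apply Rmax_r]; eapply Rle_trans; [|apply Rmax_r]);
      [apply Rmax_l|apply Rmax_r]. }
  assert (HEpos := E_pos f E E_spec).
  assert (HEmono := E_mono f f_cont f_pos f_int0 E E_spec).
  assert (HleE := le_E f f_cont f_pos f_int0 E E_spec).
  set (Y := fun t => E (c * Rmax 0 t + tau)).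
  assert (Harg : forall s, 0 < c * Rmax 0 s + tau).
  { intros s. assert (0 <= c * Rmax 0 s) by (apply Rmult_le_pos; [lra|apply Rmax_l]). lra. }
  assert (HYc : forall s, continuous Y s).
  { intros s. apply (continuous_comp (fun s => c * Rmax 0 s + tau) E).
    - apply continuous_Rplus; [|apply continuous_const].
      apply continuous_Rmult; [apply continuous_const|apply continuous_Rmax_l].
    - apply (continuous_E f f_cont f_pos f_int0 E E_spec), Harg. }
  assert (HYpos : forall s, 0 < Y s).
  { intros s. apply HEpos. specialize (Harg s); lra. }
  set (u := fun s => f (Y s)).
  assert (Huc : forall s, continuous u s).
  { intros s. apply (continuous_comp Y f); [apply HYc|apply f_cont, HYpos]. }
  assert (Hcu : forall s, continuous (conv k u) s) by (intros; apply continuous_conv; auto).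
  assert (Hslack : forall t, 0 <= t -> psi + Hint h t < (1 - theta) * Y t).
  { intros t Ht. assert (Hct : 0 <= c * t) by nra.
    unfold Y. rewrite Rmax_right by exact Ht.
    specialize (Hsup (c * t + tau - 1) ltac:(lra)).
    replace (c * t + tau - 1 + 1) with (c * t + tau) in Hsup by ring.
    set (e := E (c * t + tau - 1)) in *.
    assert (He : 0 < e) by (apply HEpos; lra).
    assert (H1 : psi <= e) by (apply HleE; lra).
    assert (H2 : Hint h t <= e).
    { destruct (Rle_dec (Hint h t) 0) as [Hn|Hp]; [lra|].
      destruct (Rle_dec T t) as [HTt|HTt].
      - apply HleE; [lra|]. eapply Rle_trans; [apply HT; lra|].
        assert (c' * t <= c * t) by (apply Rmult_le_compat_r; lra). lra.
      - apply Rle_trans with M; [|apply HleE; lra].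
        eapply Rle_trans; [apply Rle_abs|]. apply HMb; lra. }
    assert (H3 : (1 - theta) * (3 / (1 - theta) * e) <= (1 - theta) * E (c * t + tau))
      by (apply Rmult_le_compat_l; lra).
    replace ((1 - theta) * (3 / (1 - theta) * e)) with (3 * e) in H3 by (field; lra).
    lra. }
  assert (HYint : forall t, 0 <= t -> RInt (conv k u) 0 t <= theta * Y t).
  { intros t Ht.
    assert (HD : forall s, 0 < s ->
      is_derive (fun s => theta * Y s) s (theta * (c * speed f (E (c * s + tau))))).
    { intros s Hs. apply is_derive_scal.
      apply (is_derive_ext_loc (fun s => E (c * s + tau))).
      { exists (mkposreal s Hs); intros v Hv. apply Rabs_def2 in Hv; simpl in Hv.
        unfold minus, plus, opp in Hv; simpl in Hv.
        unfold Y. rewrite Rmax_right by lra. reflexivity. }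
      apply (is_derive_comp E (fun s => c * s + tau)); [|apply is_derive_affine].
      apply (is_derive_E f f_cont f_pos f_int0 E E_spec). nra. }
    assert (HDu : forall s, is_derive (fun s => RInt (conv k u) 0 s) s (conv k u s)).
    { intros s. apply is_derive_RInt_cont, Hcu. }
    assert (Hle := derive_le _ _ _ _ 0 t Ht
      (fun s _ => HDu s) (fun s Hs => HD s ltac:(lra))
      (fun s _ => is_derive_continuous _ _ _ (HDu s))
      (fun s _ => continuous_Rmult _ _ _ (continuous_const theta s) (HYc s))).
    assert (Hpt : RInt (conv k u) 0 0 = 0) by exact (RInt_point 0 (conv k u)).
    assert (HY0 : 0 <= theta * Y 0) by (apply Rmult_le_pos; [lra|apply Rlt_le, HYpos]).
    cut (RInt (conv k u) 0 t - RInt (conv k u) 0 0 <= theta * Y t - theta * Y 0);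
      [rewrite Hpt; lra|].
    apply Hle. intros s Hs. apply Hconv; lra. }
  assert (Hmain : forall t, 0 <= t -> 0 < Y t - x t).
  { apply continuous_positivity.
    - intros t _. apply continuous_Rminus; auto.
    - rewrite x_eq, volterra_0 by lra.
      assert (Hs := Hslack 0 (Rle_refl 0)). assert (HY := HYpos 0).
      assert (HH0 := H_pos 0 (Rle_refl 0)). nra.
    (* By monotonicity of f, x < Y before t bounds the memory of x by that of Y, hence by theta Y t;
       the strict slack covers psi + H. *)
    - intros t Ht Hbelow. rewrite x_eq, volterra_split by (try apply continuous_force_x; auto; lra).
      assert (RInt (conv k (fun s => f (x s))) 0 t <= RInt (conv k u) 0 t).
      { apply RInt_le; [lra| |apply ex_RInt_cont, Hcu|].
        - apply ex_RInt_cont; intros; apply continuous_conv; auto. apply continuous_force_x.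
        - intros r Hr. apply conv_le; auto; [apply continuous_force_x|lra|].
          intros s Hs. specialize (Hbelow s ltac:(lra)).
          apply (f_le f f_mono); [specialize (x_ge s); lra|lra]. }
      specialize (Hslack t ltac:(lra)). specialize (HYint t ltac:(lra)). lra. }
  exists tau; intros t Ht. specialize (Hmain t Ht).
  assert (Hct : 0 <= c * t) by nra.
  rewrite <- (proj2 (E_spec (c * t + tau) ltac:(lra))).
  apply (F_U_le f f_cont f_pos f_int0); [specialize (x_ge t); lra|].
  unfold Y in Hmain. rewrite Rmax_right in Hmain by exact Ht. lra.
Qed.

End Asymptotics.

(** * Bounded kernel mass and the equivalence of the growth conditions *)

Lemma kernel_integral_bounded (w : R -> R) :
  (forall x, continuous (kernel w) x) -> (forall x, 0 <= kernel w x) ->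
  ex_RInt_gen w (at_point 0) (Rbar_locally p_infty) ->
  exists B, forall t, 0 <= t -> RInt (kernel w) 0 t <= B.
Proof.
  intros Hc Hp [l Hl].
  destruct (Hl (fun y => y < l + 1)) as [Q S HQ [N HN] HQS].
  { exists (mkposreal 1 Rlt_0_1); intros y Hy. apply Rabs_def2 in Hy. simpl in Hy.
    unfold minus, plus, opp in Hy; simpl in Hy. lra. }
  exists (l + 1); intros t Ht.
  set (t' := Rmax t (N + 1)).
  assert (Ht' : t <= t' /\ N + 1 <= t') by (split; [apply Rmax_l|apply Rmax_r]).
  destruct (HQS 0 t' HQ (HN t' ltac:(lra))) as [y [Hy1 Hy2]]; simpl in Hy1.
  apply (is_RInt_unique w 0 t' y) in Hy1.
  assert (Heq : RInt (kernel w) 0 t' = y).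
  { rewrite <- Hy1. apply RInt_ext; intros s Hs. rewrite Rmin_left in Hs by lra.
    unfold kernel. rewrite Rmax_right by lra. reflexivity. }
  rewrite (RInt_split _ 0 t t') in Heq by (apply ex_RInt_cont, Hc).
  assert (0 <= RInt (kernel w) t t').
  { apply RInt_ge_0; [lra|apply ex_RInt_cont, Hc|auto]. }
  lra.
Qed.

Theorem theorem4p2 (f w h : R -> R) (psi : R)
  (* f in C((0,oo);(0,oo)), asymptotically increasing, f(x)/x -> oo *)
  (Hf_cont : forall x, 0 < x -> continuous f x)
  (Hf_pos : forall x, 0 < x -> 0 < f x)
  (Hf_asy : asymp_increasing f)
  (Hf_super : is_lim (fun x => f x / x) p_infty p_infty)
  (* int_0^u f(s) ds is finite (implicit in the definition of F_U) *)
  (Hf_int0 : ex_RInt_gen f (at_right 0) (at_point 1))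
  (* w in C([0,oo);[0,oo)), w(0) > 0 *)
  (Hw_cont : forall x, 0 <= x ->
      filterlim w (within (fun s => 0 <= s) (locally x)) (locally (w x)))
  (Hw_nonneg : forall x, 0 <= x -> 0 <= w x)
  (Hw0 : 0 < w 0)
  (* h in C(R;R), H(t) >= 0 for t >= 0 *)
  (Hh_cont : forall x, continuous h x)
  (HH : forall t, 0 <= t -> 0 <= Hint h t)
  (Hpsi : 0 < psi)
  (* Osgood-type condition *)
  (Hosgood : forall eta, 0 < eta ->
      is_lim (fun X => RInt (fun u => / sqrt (Fprim f u)) eta X) p_infty p_infty) :
  (* all solutions are global and positive *)
  ((exists x, is_solution f w h psi p_infty x) /\
   (forall (T : Rbar) x, is_solution f w h psi T x ->
      forall t, 0 <= t -> Rbar_lt t T -> 0 < x t) /\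
   (forall (T : R) x, is_solution f w h psi T x ->
      exists M, forall t, 0 <= t < T -> x t <= M)) /\
  (* under the further hypotheses, (i) <-> (ii) *)
  (eventually_increasing (fun x => f x / x) ->
   (forall x y, 0 < x -> x < y -> f x <= f y) ->
   ex_RInt_gen w (at_point 0) (Rbar_locally p_infty) ->
   forall x, is_solution f w h psi p_infty x ->
   ((forall eps, 0 < eps -> exists T, forall t, T <= t ->
        0 < Hint h t -> F_U f (Hint h t) / t <= sqrt (2 * w 0) + eps)
    <->
    is_lim (fun t => F_U f (x t) / t) p_infty (sqrt (2 * w 0)))).
Proof.
  split; [split; [|split]|].
  - apply global_solution_exists; assumption.
  - intros T x Hx t Ht HtT. eapply Rlt_le_trans; [exact Hpsi|].
    apply (solution_ge f w h psi) with T; assumption.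
  - intros T x Hx. apply (solution_bounded f w h psi); assumption.
  - intros Hratio Hmono Hwint x Hsol.
    assert (Hk := continuous_kernel w Hw_cont).
    assert (Hk0 := kernel_nonneg w Hw_nonneg).
    assert (Hkw : kernel w 0 = w 0) by (unfold kernel; rewrite Rmax_left by lra; reflexivity).
    rewrite <- Hkw. rewrite <- Hkw in Hw0.
    destruct (kernel_integral_bounded w Hk Hk0 Hwint) as [B HB].
    (* Extended by [x 0] to negative times, so that continuity and psi <= y hold on all of R, as the
       growth lemmas ask. *)
    set (y := fun t => x (Rmax 0 t)).
    assert (Hyx : forall t, 0 <= t -> y t = x t).
    { intros t Ht. unfold y. rewrite Rmax_right by exact Ht. reflexivity. }
    assert (Hyc : forall t, continuous y t).
    { intros t. apply continuous_clip. apply Hsol; [apply Rmax_l|exact I]. }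
    assert (Hyge : forall t, psi <= y t).
    { intros t. apply (solution_ge f w h psi Hf_cont Hf_pos Hw_cont Hw_nonneg Hh_cont HH Hpsi
        p_infty x Hsol); [apply Rmax_l|exact I]. }
    assert (Hyeq : forall t, 0 <= t -> y t = volterra (kernel w) h psi (fun s => f (y s)) t).
    { intros t Ht. rewrite Hyx by exact Ht.
      rewrite (solution_volterra f w h psi Hf_cont Hf_pos Hw_cont Hw_nonneg Hh_cont HH Hpsi
        p_infty x t Hsol Ht I) by lra.
      apply volterra_ext; [exact Ht|]. intros s Hs. unfold force.
      rewrite restrict_eq by lra. rewrite <- Hyx by lra.
      rewrite Rmax_right by apply Hyge. reflexivity. }
    assert (Hosg1 : is_lim (F_U f) p_infty p_infty) by (apply (Hosgood 1); lra).
    destruct (F_U_inverse_exists f Hf_cont Hf_pos Hf_int0 Hosg1) as [E HE].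
    assert (HL : 0 < sqrt (2 * kernel w 0)) by (apply sqrt_lt_R0; lra).
    set (L := sqrt (2 * kernel w 0)) in *.
    split.
    + intros Hi. apply is_lim_spec. intros [eps He]; simpl.
      (* The rates are L - e / 2 below and L + e / 2 above, with H controlled at rate L + e / 4; e
         <= L keeps the lower rate positive. *)
      set (e := Rmin eps L).
      assert (Hee : 0 < e /\ e <= eps /\ e <= L).
      { unfold e. split; [apply Rmin_glb_lt; lra|split; [apply Rmin_l|apply Rmin_r]]. }
      destruct (F_U_solution_lower f Hf_cont Hf_pos Hf_int0 Hmono Hf_super E HE
        (kernel w) h Hk Hk0 Hw0 Hh_cont HH psi Hpsi y Hyc Hyge Hyeq (L - e / 2))
        as [A1 [B1 Hlow]]; [lra|fold L; lra|].
      destruct (Hi (e / 4)) as [T HT]; [lra|].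
      destruct (F_U_solution_upper f Hf_cont Hf_pos Hf_int0 Hmono Hf_super E HE
        (kernel w) h Hk Hk0 Hw0 Hh_cont HH psi Hpsi y Hyc Hyge Hyeq Hratio B HB
        (L + e / 2) (L + e / 4) (Rmax 1 T)) as [tau Hup]; [fold L; lra|lra| |].
      { intros t Ht _ HHt. assert (Ht' : 1 <= t /\ T <= t).
        { generalize (Rmax_l 1 T) (Rmax_r 1 T); lra. }
        specialize (HT t (proj2 Ht') HHt).
        apply (Rmult_le_compat_r t) in HT; [|lra].
        unfold Rdiv in HT. rewrite Rmult_assoc, Rinv_l, Rmult_1_r in HT by lra. exact HT. }
      (* C dominates both additive offsets; for t > 2 C / e they cost less than (e / 2) t, on top of
         the e / 2 lost in the rates. *)
      set (C := Rabs B1 + Rabs tau + 1).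
      assert (HC : 0 < C /\ B1 < C /\ tau < C).
      { unfold C. generalize (Rabs_pos B1) (Rabs_pos tau) (Rle_abs B1) (Rle_abs tau). lra. }
      exists (Rmax A1 (2 * C / e)); intros t Ht.
      assert (HCe : 0 < 2 * C / e) by (apply Rdiv_lt_0_compat; lra).
      assert (Ht' : A1 < t /\ 2 * C / e < t).
      { generalize (Rmax_l A1 (2 * C / e)) (Rmax_r A1 (2 * C / e)); lra. }
      assert (HCt : C < e / 2 * t).
      { replace C with (e / 2 * (2 * C / e)) by (field; lra). apply Rmult_lt_compat_l; lra. }
      specialize (Hlow t ltac:(lra)). specialize (Hup t ltac:(lra)).
      rewrite Hyx in Hlow, Hup by lra.
      eapply Rlt_le_trans; [|apply (proj1 (proj2 Hee))].
      replace (F_U f (x t) / t - L) with ((F_U f (x t) - L * t) / t) by (field; lra).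
      apply Rabs_def1; apply Rmult_lt_reg_r with t; try lra;
        unfold Rdiv; rewrite Rmult_assoc, Rinv_l by lra; lra.
    + intros Hlim eps He. apply is_lim_spec in Hlim.
      destruct (Hlim (mkposreal eps He)) as [T HT]; simpl in HT.
      exists (Rmax 1 (T + 1)); intros t Ht HHt.
      assert (Ht' : 1 <= t /\ T < t).
      { generalize (Rmax_l 1 (T + 1)) (Rmax_r 1 (T + 1)); lra. }
      specialize (HT t (proj2 Ht')). apply Rabs_def2 in HT.
      apply Rle_trans with (F_U f (x t) / t); [|lra].
      apply Rmult_le_compat_r; [apply Rlt_le, Rinv_0_lt_compat; lra|].
      apply (F_U_le f Hf_cont Hf_pos Hf_int0); [exact HHt|].
      rewrite <- Hyx, Hyeq by lra.
      assert (Hfc : forall s, continuous (fun s => f (y s)) s).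
      { intros s. apply (continuous_comp y f); [apply Hyc|apply Hf_cont].
        specialize (Hyge s); lra. }
      rewrite volterra_split by auto.
      assert (0 <= RInt (conv (kernel w) (fun s => f (y s))) 0 t).
      { apply RInt_ge_0; [lra| |].
        - apply ex_RInt_cont; intros; apply continuous_conv; auto.
        - intros r Hr. apply conv_nonneg; auto; [lra|].
          intros s _. apply Rlt_le, Hf_pos. specialize (Hyge s); lra. }
      lra.
Qed.
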